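(* Let $X$ be a Fréchet space and let $\|\cdot\|\colon X\to[0,\infty)$ be a seminorm. Then the following assertions are equivalent: (1) there is a topological embedding $V\colon X\hookrightarrow s$ such that $\|Vx\|_{\ell_2}=\|x\|$ for all $x\in X$; (2) $X$ is nuclear and $\|\cdot\|$ is a dominating Hilbert norm on $X$.
   Context: All spaces are over $\mathbb C$. A Fréchet space is a complete metrizable locally convex space. $s=\{\xi\in\mathbb C^{\mathbb N}: |\xi|_q:=(\sum_{j=1}^\infty|\xi_j|^2j^{2q})^{1/2}<\infty \text{ for all } q\in\mathbb N_0\}$ is the Fréchet space of rapidly decreasing sequences with the norms $(|\cdot|_q)_{q\in\mathbb N_0}$. A topological embedding is a linear map which is a homeomorphism onto its image. A Hilbert norm is a norm induced by an inner product. If $(\|\cdot\|_q)_{q\in\mathbb N_0}$ is an increasing fundamental system of seminorms of $X$, a continuous norm $\|\cdot\|$ on $X$ is called a dominating norm if for all $q\in\mathbb N_0$ there are $r\in\mathbb N_0$ and $C>0$ such that $\|x\|_q^2\le C\|x\|\,\|x\|_r$ for all $x\in X$. *)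

(* Defs.v *)
(* The scalar field C is R[i] for R : realType. *)
From HB Require Import structures.
From mathcomp Require Import all_boot all_order all_algebra.
From mathcomp Require Import sesquilinear.
From mathcomp Require Import all_classical all_reals all_analysis.
From mathcomp Require Import complex ring.
Set Implicit Arguments.
Unset Strict Implicit.
Unset Printing Implicit Defensive.
Import Order.TTheory GRing.Theory Num.Theory.
Import numFieldNormedType.Exports.
Local Open Scope classical_set_scope.
Local Open Scope ring_scope.

(* The modulus |z| of z : R[i], as an element of R. *)
Notation modulus := ComplexField.Normc.normc (only parsing).

Section Seminorms.
Context {R : realType} {X : lmodType R[i]}.

Definition is_seminorm (p : X -> R) : Prop :=
  [/\ forall x, 0 <= p x,
      forall x y, p (x + y) <= p x + p y
    & forall (a : R[i]) x, p (a *: x) = modulus a * p x].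

Definition is_norm (p : X -> R) : Prop :=
  is_seminorm p /\ forall x, p x = 0 -> x = 0.

(* A form {dot X for conj} is linear in its first variable, conjugate-linear in
   the second, hermitian and positive definite. *)
Definition is_hilbert_norm (p : X -> R) : Prop :=
  is_norm p /\
  exists f : {dot X for (@Num.conj R[i])},
    forall x, f x x = ((p x) ^+ 2)%:C%C.

(* The local Banach space of a seminorm p is the completion of the normed space
   X / ker p.  Its points are represented by the p-Cauchy sequences z in X, the
   norm of the point represented by z being the limit of p (z m); the canonical
   map sends x to the constant sequence x. *)
Definition seminorm_cauchy (p : X -> R) (z : nat -> X) : Prop :=
  forall e : R, 0 < e ->
    exists N, forall m k, (N <= m)%N -> (N <= k)%N -> p (z m - z k) < e.

Definition completion_norm (p : X -> R) (z : nat -> X) : R :=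
  limn (fun m => p (z m)).

(* Nuclearity of the linking map, induced by the identity of X, from the local
   Banach space of q to that of p (for p <= q): it is x |-> \sum_n y_n(x) z_n,
   with y_n a q-bounded functional of dual norm at most c_n (these are the
   functionals on the local Banach space of q), z_n a point of the local
   Banach space of p, and \sum_n c_n ||z_n|| finite. *)
Definition nuclear_link (q p : X -> R) : Prop :=
  exists (y : nat -> {scalar X}) (c : nat -> R) (z : nat -> nat -> X),
    [/\ forall n, 0 <= c n /\ forall x, modulus (y n x) <= c n * q x,
        forall n, seminorm_cauchy p (z n),
        cvgn (series (fun n => c n * completion_norm p (z n)))
      & forall x,
          (fun N => completion_norm p
             (fun m => x - \sum_(0 <= n < N) y n x *: z n m)) @ \oo --> (0 : R)].

End Seminorms.

Section LocallyConvexSpaces.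
Context {R : realType} (X : tvsType R[i]).

Definition metrizable : Prop :=
  exists d : X -> X -> R,
    [/\ forall x y, d x y = 0 <-> x = y,
        forall x y, d x y = d y x,
        forall x y z, d x z <= d x y + d y z
      & forall (x : X) (A : set X),
          nbhs x A <-> exists2 e : R, 0 < e & [set y | d x y < e] `<=` A].

(* Completeness for the translation-invariant uniformity of X.  The uniformity
   carried by a tvsType is not required to be that one, hence [cauchy] is not
   used here. *)
Definition tvs_complete : Prop :=
  forall F : set_system X, ProperFilter F ->
    (fun z : X * X => z.1 - z.2) @ (F, F) --> (0 : X) ->
    exists x : X, F --> x.

Definition frechet : Prop := metrizable /\ tvs_complete.

Definition nuclear : Prop :=
  forall p : X -> R, is_seminorm p -> continuous p ->
    exists q : X -> R,
      [/\ is_seminorm q, continuous q, forall x, p x <= q x & nuclear_link q p].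

Definition increasing_fundamental_system (p : nat -> X -> R) : Prop :=
  [/\ forall q, is_seminorm (p q),
      forall q x, p q x <= p q.+1 x
    & forall A : set X,
        nbhs (0 : X) A <->
        exists q, exists2 e : R, 0 < e & [set x | p q x < e] `<=` A].

(* The inequalities do not depend on the choice of the increasing fundamental
   system of seminorms: any two such systems dominate each other up to
   constants. *)
Definition dominating_norm (nrm : X -> R) : Prop :=
  [/\ is_norm nrm, continuous nrm
    & exists p : nat -> X -> R, increasing_fundamental_system p /\
        forall q, exists r, exists2 C : R, 0 < C &
          forall x, (p q x) ^+ 2 <= C * nrm x * p r x].

End LocallyConvexSpaces.

(* A linear topological embedding is a linear V satisfying this predicate: g
   is a continuous inverse of V on its image. *)
Definition homeo_onto_image (T U : topologicalType) (V : T -> U) : Prop :=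
  continuous V /\
  exists g : U -> T, cancel V g /\ {within range V, continuous g}.

Section SpaceS.
Context (R : realType).

Local Open Scope ereal_scope.

(* Sequences indexed from 1 are represented by functions on nat: the coordinate
   of index j + 1 is xi j, with weight (j + 1)^(2q). *)
Definition wsum (q : nat) (xi : nat -> R[i]) : \bar R :=
  \sum_(0 <= j <oo) ((modulus (xi j)) ^+ 2 * (j.+1%:R) ^+ (2 * q))%R%:E.

Definition rapidly_decreasing : set (nat -> R[i]) :=
  [set xi | forall q, wsum q xi < +oo].

Definition s_pred : {pred nat -> R[i]} := mem rapidly_decreasing.

Record s_space := SSpace { s_seq :> nat -> R[i] ; _ : s_seq \in s_pred }.

Definition s_norm (q : nat) (xi : nat -> R[i]) : R := Num.sqrt (fine (wsum q xi)).

Definition l2_norm (xi : nat -> R[i]) : R :=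
  Num.sqrt (fine (\sum_(0 <= j <oo) ((modulus (xi j)) ^+ 2)%R%:E)).


Let term_ge0 q (xi : nat -> R[i]) j :
  0 <= ((modulus (xi j)) ^+ 2 * (j.+1%:R) ^+ (2 * q))%R%:E.
Proof. by rewrite lee_fin mulr_ge0// ?sqr_ge0// exprn_ge0. Qed.

Lemma le_wsum (q r : nat) (xi : nat -> R[i]) : (q <= r)%N ->
  wsum q xi <= wsum r xi.
Proof.
move=> qr; apply: lee_nneseries => [j _ _|j _]; first exact: term_ge0.
rewrite lee_fin ler_wpM2l ?sqr_ge0// ler_weXn2l ?leq_mul2l ?qr ?orbT//.
by rewrite ler1n.
Qed.

Lemma wsum_ge0 q xi : 0 <= wsum q xi.
Proof. by apply: nneseries_ge0 => j _ _; exact: term_ge0. Qed.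

Lemma s_pred_submod : submod_closed s_pred.
Proof.
split=> [|a u v].
  rewrite inE => q; rewrite /wsum eseries0 ?ltry// => j _ _.
  by rewrite [X in modulus X](_ : _ = 0%R :> R[i])// ComplexField.Normc.normc0 expr0n/= mul0r.
rewrite !inE => hu hv q.
pose A := (2 * modulus a ^+ 2)%R.
have A0 : (0 <= A)%R by rewrite mulr_ge0 ?sqr_ge0.
apply: (@le_lt_trans _ _ (A%:E * wsum q u + 2%:E * wsum q v)).
  rewrite /wsum -!nneseriesZl//; try by move=> *; exact: term_ge0.
  rewrite -nneseriesD; try by move=> *; rewrite mule_ge0 ?term_ge0.
  apply: lee_nneseries => [j _ _|j _]; first exact: term_ge0.
  set W := ((j.+1%:R : R) ^+ (2 * q))%R.
  rewrite -!EFinM -EFinD lee_fin.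
  suff step : (modulus ((a *: u + v) j) ^+ 2
      <= A * modulus (u j) ^+ 2 + 2 * modulus (v j) ^+ 2)%R.
    rewrite [leRHS](_ : _ = (A * modulus (u j) ^+ 2
      + 2 * modulus (v j) ^+ 2) * W)%R; last by ring.
    by rewrite ler_wpM2r // /W exprn_ge0 // ler0n.
  have -> : (A * modulus (u j) ^+ 2 = 2 * modulus (a * u j) ^+ 2)%R.
    by rewrite ComplexField.Normc.normcM /A; ring.
  have := @le_normcD R (a * u j)%R (v j).
  rewrite [X in (modulus X ^+ 2)%R](_ : _ = (a * u j + v j)%R)//.
  set s := modulus (_ + _)%R; set t := modulus (_ * _)%R; set w := modulus _.
  move=> h; have s0 : (0 <= s)%R.
    by rewrite /s; case: (_ + _)%R => x y; rewrite sqrtr_ge0.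
  apply: (@le_trans _ _ ((t + w) ^+ 2)%R); first by rewrite lerXn2r// nnegrE (le_trans s0).
  by rewrite -subr_ge0 (_ : _ - _ = (t - w) ^+ 2)%R ?sqr_ge0//; ring.
by rewrite lte_add_pinfty// lte_mul_pinfty// ?wsum_ge0.
Qed.

HB.instance Definition _ := [isSub for s_seq].
HB.instance Definition _ := [Choice of s_space by <:].
HB.instance Definition _ :=
  GRing.isSubmodClosed.Build R[i] (nat -> R[i]) s_pred s_pred_submod.
HB.instance Definition _ := [SubChoice_isSubLmodule of s_space by <:].

Local Open Scope ring_scope.

(* The topology of s given by the norms |.|_q: as they increase with q, a set
   is open iff it contains some ball of some |.|_q around each of its points. *)
Definition s_open : set_system s_space :=
  [set U | forall x : s_space, U x ->
     exists q, exists2 e : R, 0 < e &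
       [set y : s_space | s_norm q (y - x : s_space) < e] `<=` U].

Lemma s_norm_le (q r : nat) (x : s_space) : (q <= r)%N ->
  s_norm q x <= s_norm r x.
Proof.
case: x => xi hx qr; have hxi : rapidly_decreasing xi by move: hx; rewrite inE.
rewrite /s_norm /=; apply: ler_wsqrtr; apply: fine_le; last exact: le_wsum.
- by rewrite ge0_fin_numE ?wsum_ge0.
- by rewrite ge0_fin_numE ?wsum_ge0.
Qed.

Lemma s_openT : s_open setT.
Proof. by move=> x _; exists 0%N, 1. Qed.

Lemma s_openI : setI_closed s_open.
Proof.
move=> A B oA oB x [/oA[q [d d0 dA]] /oB[r [e e0 eB]]].
exists (maxn q r), (Num.min d e); first by rewrite lt_min d0.
move=> y; rewrite /mkset lt_min => /andP[yd ye]; split.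
  by apply: dA; rewrite /mkset (le_lt_trans _ yd)// s_norm_le// leq_maxl.
by apply: eB; rewrite /mkset (le_lt_trans _ ye)// s_norm_le// leq_maxr.
Qed.

Lemma s_open_bigU (I : Type) (f : I -> set s_space) :
  (forall i, s_open (f i)) -> s_open (\bigcup_i f i).
Proof.
move=> of_ x [i _ /of_[q [e e0 h]]]; exists q, e => // y /h fy.
by exists i.
Qed.

HB.instance Definition _ :=
  isOpenTopological.Build s_space s_openT s_openI s_open_bigU.

End SpaceS.

(* Main.v *)
Require Import Defs.
From HB Require Import structures.
From Stdlib Require PeanoNat.
From mathcomp Require Import all_boot all_order all_algebra.
From mathcomp Require Import sesquilinear.
From mathcomp Require Import all_classical all_reals all_analysis.
From mathcomp Require Import complex ring lra zify.
Set Implicit Arguments.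
Unset Strict Implicit.
Unset Printing Implicit Defensive.
Import Order.TTheory GRing.Theory Num.Theory.
Import numFieldNormedType.Exports.
Local Open Scope classical_set_scope.
Local Open Scope ring_scope.
(** The two implications rest on different ideas.

    Suppose first that [V] embeds the space isometrically.  The seminorms
    [s_norm q (V x)] form a fundamental system, they come from semi-inner
    products, and the inequality between them and the l2 norm is the
    Cauchy-Schwarz inequality ([s_norm_interpolation]).  Nuclearity needs no
    eigenvector expansion ([embedding_nuclear]): the expansion of a sequence
    along the unit vectors [e_n], projected orthogonally onto the closure of
    the image, writes [x] as [\sum_n (V x)_n P e_n], and the norm of index
    [q + 2] of [x] together with the norms of index [q] of the [e_n] make this
    series absolutely summable.

    Conversely, an isometric embedding is a sequence of functionals [v_j] that
    decay rapidly in [j] (for each rate, for one of the norms of the space),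
    that control each of these norms, and whose squares sum to the square of
    the given norm.

    Nuclearity provides a sequence of semi-inner products with norms [h k],
    fundamental for the topology, whose consecutive links are Hilbert-Schmidt
    ([nuclear_hs_form], [dominating_hilbert_scale]).  Composing links, finite
    sets of polynomial size approximate the space faster than every power, and
    the Gram-Schmidt coordinates along them decay rapidly, for every form that
    is dominated by the scale ([fast_coordinates]).  For the given norm this
    is already an isometric continuous map into s, with an inverse that need
    not be continuous; for [h q] it gives functionals that control [h q], but
    those of infinitely many [q] do not fit into one sequence: for a given [r],
    the functionals that control [h q] need not be bounded for [h r] when [q] is
    large, and no weight makes them decay there.

    The dominating property overcomes this.  In dual form it splits a
    functional bounded for [h q] into a large part bounded for the given norm
    and a small part bounded for [h q.+1] ([dual_splitting]).  Repeating this on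
    the small part, in the manner of Mittag-Leffler, approximates the functional
    by functionals of the given norm of size [O(s)] with an error below every
    power of [s^-1] ([simultaneous_approximation]).  The increments of these
    approximations still control [h q], and they are all bounded for the
    weakest norm: a weight [s^-q] makes those of large [q] decay, so that all
    of them fit into one sequence ([controlling_functionals]).  Scaled down, its
    squares sum to at most the square of the given norm; what is missing is
    again the square of a Hilbert seminorm, whose coordinates are interleaved
    ([isometric_functionals]).

    Hilbert spaces are not completed: functionals are represented by vectors of
    the given space up to arbitrarily small errors ([approximate_riesz]). *)

Local Notation Re := (@complex.Re _).
Local Notation Im := (@complex.Im _).

(** * Complex numbers and elementary inequalities *)

Section Modulus.
Context {R : realType}.
Implicit Types z w : R[i].

Lemma modulus_ge0 z : 0 <= modulus z.
Proof. by case: z => a b; rewrite sqrtr_ge0. Qed.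

Lemma sqr_modulus z : modulus z ^+ 2 = Re z ^+ 2 + Im z ^+ 2.
Proof. by case: z => a b /=; rewrite sqr_sqrtr// addr_ge0// sqr_ge0. Qed.

Lemma mulc_conj z : z * conjc z = (modulus z ^+ 2)%:C%C.
Proof.
rewrite sqr_modulus; case: z => a b; apply/eqP; rewrite eq_complex /=.
by apply/andP; split; apply/eqP; ring.
Qed.

Lemma modulus_conj z : modulus (conjc z) = modulus z.
Proof. by case: z => a b /=; rewrite sqrrN. Qed.

Lemma modulus_real (a : R) : modulus a%:C%C = `|a|.
Proof. by rewrite /= expr0n addr0 sqrtr_sqr. Qed.

Lemma normr_Re_le z : `|Re z| <= modulus z.
Proof.
rewrite -(ler_pXn2r (ltn0Sn 1)) ?nnegrE ?modulus_ge0// sqr_modulus.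
by rewrite real_normK ?num_real// lerDl sqr_ge0.
Qed.

Lemma conjM z w : conjc (z * w) = conjc z * conjc w.
Proof. exact: rmorphM. Qed.

Lemma conjD z w : conjc (z + w) = conjc z + conjc w.
Proof. exact: rmorphD. Qed.

Lemma conjN z : conjc (- z) = - conjc z.
Proof. exact: rmorphN. Qed.

Lemma realM (a b : R) : (a * b)%:C%C = a%:C%C * b%:C%C.
Proof. exact: rmorphM. Qed.

Lemma ReD z w : Re (z + w) = Re z + Re w.
Proof. by case: z w => a b []. Qed.

Lemma ReN z : Re (- z) = - Re z.
Proof. by case: z. Qed.

Lemma ReB z w : Re (z - w) = Re z - Re w.
Proof. by rewrite ReD ReN. Qed.

Lemma modulus_sum (I : Type) (r : seq I) (F : I -> R[i]) :
  modulus (\sum_(i <- r) F i) <= \sum_(i <- r) modulus (F i).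
Proof.
elim/big_ind2: _ => // [|x a y b xa yb]; first by rewrite ComplexField.Normc.normc0.
by rewrite (le_trans (le_normcD _ _))// lerD.
Qed.

End Modulus.

Lemma le_of_eq (R : realType) (a b : R) : a = b -> a <= b.
Proof. by move->. Qed.

Lemma le_of_sqr_le_mul (R : realType) (a b : R) : 0 <= a -> 0 <= b ->
  a ^+ 2 <= b * a -> a <= b.
Proof.
rewrite le_eqVlt => /predU1P[<-//|a0] _; by rewrite expr2 ler_pM2r.
Qed.

(** A quadratic inequality in a real parameter; the substitute for a
    discriminant that also covers a vanishing leading coefficient. *)
Lemma quadratic_nonneg_le (R : realType) (d E H : R) : 0 <= d -> 0 <= E -> 0 <= H ->
  (forall t, 0 <= t -> 2 * t * d <= E + t ^+ 2 * d * H) -> d <= E * H.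
Proof.
move=> d0 E0; rewrite le_eqVlt => /predU1P[<- h|H0 h].
  rewrite mulr0 leNgt; apply/negP => dp.
  have := h ((E + 1) / d); rewrite divr_ge0 ?addr_ge0// => /(_ isT).
  by rewrite mulr0 addr0 -mulrA divfK ?gt_eqF//; lra.
have := h H^-1; rewrite invr_ge0 ltW// => /(_ isT).
rewrite expr2 -!mulrA (mulrC d H) (mulrA _ H d) mulVf ?gt_eqF// mul1r.
move=> {}h; have : H^-1 * d <= E by lra.
by rewrite mulrC ler_pdivrMr.
Qed.

Lemma sqr_le_of_quadratic (R : realType) (A T H : R) : 0 <= A -> 0 <= T -> 0 <= H ->
  (forall s, 0 <= s -> 2 * s * A <= T + s ^+ 2 * H) -> A ^+ 2 <= T * H.
Proof.
move=> A0 T0 H0 h; apply: quadratic_nonneg_le => //; first exact: sqr_ge0.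
move=> t t0; have := h (t * A); rewrite mulr_ge0// => /(_ isT).
by rewrite exprMn; lra.
Qed.

(** * Semi-inner products *)

Section Forms.
Context {R : realType} {X : lmodType R[i]}.
Implicit Types (B : X -> X -> R[i]) (x y z : X).

(** A semi-inner product; forms obtained as differences or limits of others are
    in general not definite. *)
Record psd_form B : Prop := PsdForm {
  psd_lin : forall a x y z, B (a *: x + y) z = a * B x z + B y z;
  psd_conj : forall x y, B y x = conjc (B x y);
  psd_ge0 : forall x, 0 <= Re (B x x) }.

Definition form_norm B x : R := Num.sqrt (Re (B x x)).

Section Theory.
Variable B : X -> X -> R[i].
Hypothesis HB : psd_form B.
Local Notation h := (form_norm B).

Lemma form_norm_ge0 x : 0 <= h x. Proof. exact: sqrtr_ge0. Qed.

Lemma form_diag x : B x x = (h x ^+ 2)%:C%C.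
Proof.
rewrite sqr_sqrtr ?psd_ge0//.
have := psd_conj HB x x; case: (B x x) => a b /= [] hb.
congr Complex; by lra.
Qed.

Lemma sqr_form_norm x : h x ^+ 2 = Re (B x x).
Proof. by rewrite form_diag. Qed.

Lemma form0l z : B 0 z = 0.
Proof.
have := psd_lin HB 1 0 0 z; rewrite scaler0 addr0 mul1r => /eqP.
by rewrite -subr_eq0 opprD addrA subrr sub0r oppr_eq0 => /eqP.
Qed.

Lemma formZl a x z : B (a *: x) z = a * B x z.
Proof. by have := psd_lin HB a x 0 z; rewrite addr0 form0l addr0. Qed.

Lemma formDl x y z : B (x + y) z = B x z + B y z.
Proof. by have := psd_lin HB 1 x y z; rewrite scale1r mul1r. Qed.

Lemma formNl x z : B (- x) z = - B x z.
Proof. by rewrite -scaleN1r formZl mulN1r. Qed.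

Lemma formBl x y z : B (x - y) z = B x z - B y z.
Proof. by rewrite formDl formNl. Qed.

Lemma form_suml (I : Type) (r : seq I) (F : I -> X) z :
  B (\sum_(i <- r) F i) z = \sum_(i <- r) B (F i) z.
Proof.
elim: r => [|i r IH]; first by rewrite !big_nil form0l.
by rewrite !big_cons formDl IH.
Qed.

Lemma form0r z : B z 0 = 0.
Proof. by rewrite (psd_conj HB) form0l conjc0. Qed.

Lemma formZr a x z : B z (a *: x) = conjc a * B z x.
Proof. by rewrite [LHS](psd_conj HB) formZl conjM [in RHS](psd_conj HB). Qed.

Lemma formDr x y z : B z (x + y) = B z x + B z y.
Proof. by rewrite [LHS](psd_conj HB) formDl conjD [B z x](psd_conj HB) [B z y](psd_conj HB). Qed.

Lemma formNr x z : B z (- x) = - B z x.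
Proof. by rewrite [LHS](psd_conj HB) formNl conjN [in RHS](psd_conj HB). Qed.

Lemma formBr x y z : B z (x - y) = B z x - B z y.
Proof. by rewrite formDr formNr. Qed.

Lemma form_sumr (I : Type) (r : seq I) (F : I -> X) z :
  B z (\sum_(i <- r) F i) = \sum_(i <- r) B z (F i).
Proof.
elim: r => [|i r IH]; first by rewrite !big_nil form0r.
by rewrite !big_cons formDr IH.
Qed.

Lemma sqr_form_normD x y :
  h (x + y) ^+ 2 = h x ^+ 2 + 2 * Re (B x y) + h y ^+ 2.
Proof.
rewrite !sqr_form_norm formDl !formDr [B y x](psd_conj HB).
by case: (B x y) => a b; rewrite !ReD /=; lra.
Qed.

Lemma form_normZ a x : h (a *: x) = modulus a * h x.
Proof.
apply/eqP; rewrite -(@eqrXn2 _ 2)// ?mulr_ge0 ?form_norm_ge0 ?modulus_ge0//.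
rewrite exprMn sqr_form_norm formZl formZr mulrA mulc_conj form_diag.
by rewrite -rmorphM.
Qed.

Lemma form_cauchy_schwarz x y : modulus (B x y) <= h x * h y.
Proof.
rewrite -(ler_pXn2r (ltn0Sn 1)) ?nnegrE ?mulr_ge0 ?form_norm_ge0 ?modulus_ge0//.
rewrite exprMn; apply: quadratic_nonneg_le; rewrite ?sqr_ge0// => t t0.
set c := (- t)%:C%C * B x y.
have := sqr_ge0 (h (x + c *: y)).
rewrite sqr_form_normD formZr form_normZ exprMn.
have -> : conjc c * B x y = (- t * modulus (B x y) ^+ 2)%:C%C.
  by rewrite /c conjM conjc_real -mulrA [conjc _ * _]mulrC mulc_conj -realM.
have -> : modulus c ^+ 2 = t ^+ 2 * modulus (B x y) ^+ 2.
  rewrite /c ComplexField.Normc.normcM modulus_real normrN exprMn.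
  by rewrite real_normK ?num_real.
rewrite /=; lra.
Qed.

Lemma form_normD x y : h (x + y) <= h x + h y.
Proof.
rewrite -(ler_pXn2r (ltn0Sn 1)) ?nnegrE ?addr_ge0 ?form_norm_ge0//.
rewrite sqr_form_normD sqrrD lerD2r lerD2l -[leRHS]mulr_natl ler_pM2l//.
apply: le_trans (form_cauchy_schwarz x y); apply: le_trans (normr_Re_le _).
exact: ler_norm.
Qed.

Lemma form_norm_seminorm : is_seminorm h.
Proof. split; [exact: form_norm_ge0|exact: form_normD|exact: form_normZ]. Qed.

(** The Riesz representation, up to an arbitrarily small error so that the
    representing vector lies in the space itself: it nearly minimizes
    [h z ^+ 2 - 2 * Re (y z)]. *)
Lemma approximate_riesz (y : X -> R[i]) (C e : R) : scalar y ->
  (forall x, modulus (y x) <= C * h x) -> 0 < e ->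
  exists z, forall x, modulus (y x - B x z) <= e * h x.
Proof.
move=> ylin yC e0.
have y0 : y 0 = 0.
  have := ylin 1 0 0; rewrite scaler0 addr0 mul1r => /eqP.
  by rewrite -subr_eq0 opprD addrA subrr sub0r oppr_eq0 => /eqP.
pose J z := h z ^+ 2 - 2 * Re (y z).
have Jlb : lbound (range J) (- C ^+ 2).
  move=> _ [z _ <-]; rewrite /J.
  have := le_trans (ler_norm _) (le_trans (normr_Re_le (y z)) (yC z)).
  have := sqr_ge0 (h z - C); rewrite sqrrB; lra.
have Jinf : has_inf (range J) by split; [exists (J 0), 0|exists (- C ^+ 2)].
have [_ [z _ <-] Jz] := inf_adherent (exprn_gt0 2 e0) Jinf.
have Jmin x : J z - e ^+ 2 <= J x.
  have : inf (range J) <= J x by apply: ge_inf; [case: Jinf|exists x].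
  by lra.
exists z => x.
rewrite -(ler_pXn2r (ltn0Sn 1)) ?nnegrE ?mulr_ge0 ?form_norm_ge0 ?modulus_ge0 ?(ltW e0)//.
rewrite exprMn; apply: quadratic_nonneg_le; rewrite ?sqr_ge0// => t t0.
set D := y x - B x z.
pose c := t%:C%C * conjc D.
have := Jmin (z + c *: x).
rewrite /J sqr_form_normD formZr form_normZ exprMn.
have -> : y (z + c *: x) = c * y x + y z by rewrite addrC ylin.
have -> : modulus c ^+ 2 = t ^+ 2 * modulus D ^+ 2.
  by rewrite /c ComplexField.Normc.normcM modulus_conj modulus_real exprMn real_normK ?num_real.
have -> : Re (conjc c * B z x) = Re (c * B x z).
  by rewrite (psd_conj HB x z) -conjM; case: (c * _).
have : Re (c * y x) - Re (c * B x z) = t * modulus D ^+ 2.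
  rewrite -ReB -mulrBr -/D /c -mulrA [conjc _ * _]mulrC mulc_conj -realM.
  by [].
rewrite !ReD; lra.
Qed.

End Theory.

Lemma psd_form_add B1 B2 : psd_form B1 -> psd_form B2 ->
  psd_form (fun x y => B1 x y + B2 x y).
Proof.
move=> H1 H2; split => [a x y z|x y|x].
- by rewrite (psd_lin H1) (psd_lin H2); ring.
- by rewrite (psd_conj H1) (psd_conj H2) conjD.
- by rewrite ReD addr_ge0// ?(psd_ge0 H1) ?(psd_ge0 H2).
Qed.

Lemma psd_form_sub B1 B2 : psd_form B1 -> psd_form B2 ->
  (forall x, form_norm B2 x <= form_norm B1 x) ->
  psd_form (fun x y => B1 x y - B2 x y).
Proof.
move=> H1 H2 le21; split => [a x y z|x y|x].
- by rewrite (psd_lin H1) (psd_lin H2); ring.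
- by rewrite (psd_conj H1) (psd_conj H2) conjD conjN.
- rewrite ReB /= subr_ge0 -(sqr_form_norm H1) -(sqr_form_norm H2).
  by rewrite lerXn2r ?nnegrE ?form_norm_ge0.
Qed.

Lemma psd_form_scale (a : R) B : 0 <= a -> psd_form B ->
  psd_form (fun x y => a%:C%C * B x y).
Proof.
move=> a0 H; split => [c x y z|x y|x].
- by rewrite (psd_lin H); ring.
- by rewrite (psd_conj H) conjM conjc_real.
- by rewrite (form_diag H) -realM /= mulr_ge0// sqr_ge0.
Qed.

Lemma psd_form_functional (w : X -> R[i]) : scalar w ->
  psd_form (fun x y => w x * conjc (w y)).
Proof.
move=> wl; split => [c x y z|x y|x].
- by rewrite wl; ring.
- by rewrite conjM conjcK mulrC.
- by rewrite mulc_conj /= sqr_ge0.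
Qed.

Lemma psd_form_sum (w : nat -> X -> R[i]) n : (forall k, scalar (w k)) ->
  psd_form (fun x y => \sum_(0 <= k < n) w k x * conjc (w k y)).
Proof.
move=> wl; elim: n => [|n IH].
  by split=> [a x y z|x y|x]; rewrite !big_geq// ?mulr0 ?addr0// conjc0.
have -> : (fun x y => \sum_(0 <= k < n.+1) w k x * conjc (w k y)) =
    (fun x y => \sum_(0 <= k < n) w k x * conjc (w k y) + w n x * conjc (w n y)).
  by apply/funext => x; apply/funext => y; rewrite big_nat_recr.
by apply: psd_form_add => //; exact: psd_form_functional.
Qed.

End Forms.

(** * Limits of sums of squared functionals *)

Section RealSeries.
Context {R : realType}.
Implicit Types u : nat -> R.

Lemma sum_inv_sq_le n : \sum_(0 <= j < n) (j.+1%:R : R) ^- 2 <= 2.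
Proof.
case: n => [|n]; first by rewrite big_geq.
suff : \sum_(0 <= j < n.+1) (j.+1%:R : R) ^- 2 <= 2 - n.+1%:R^-1.
  by move/le_trans; apply; rewrite gerBl invr_ge0.
elim: n => [|n IH]; first by rewrite big_nat1 expr1n invr1; lra.
rewrite big_nat_recr//=; apply: le_trans (lerD IH (lexx _)) _.
have a0 : 0 < n.+1%:R :> R by [].
have -> : n.+2%:R = n.+1%:R + 1 :> R by rewrite -natr1.
move: (n.+1%:R) a0 => a a0.
have a1 : 0 < a + 1 by lra.
rewrite -subr_ge0.
have -> : 2 - (a + 1)^-1 - (2 - a^-1 + (a + 1) ^- 2) = (a * (a + 1) ^+ 2)^-1.
  by field; rewrite !gt_eqF.
by rewrite invr_ge0 mulr_ge0 ?sqr_ge0// ltW.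
Qed.

Lemma nneg_series_cvg u M : (forall n, 0 <= u n) ->
  (forall n, \sum_(0 <= k < n) u k <= M) -> cvgn (series u).
Proof.
move=> u0 uM; apply: nondecreasing_is_cvgn.
  by apply/nondecreasing_seqP => n; rewrite /series /= big_nat_recr//= lerDl.
by exists M => _ [n _ <-]; exact: uM.
Qed.

Lemma nneg_series_le u l n : (forall n, 0 <= u n) ->
  series u @ \oo --> l -> \sum_(0 <= k < n) u k <= l.
Proof.
move=> u0 ul; rewrite -(cvg_lim _ ul)//.
apply: (@nondecreasing_cvgn_le _ (series u)).
  by apply/nondecreasing_seqP => m; rewrite /series /= big_nat_recr//= lerDl.
by apply/cvg_ex; exists l.
Qed.

Lemma cvgn_le_bound u l M : u @ \oo --> l -> (forall n, u n <= M) -> l <= M.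
Proof.
move=> ul uM; rewrite -(cvg_lim _ ul)//; apply: limr_le.
  by apply/cvg_ex; exists l.
by near=> n; exact: uM.
Unshelve. all: by end_near. Qed.

Lemma sum_cvgn (v : nat -> nat -> R) l m :
  (forall i, v i @ \oo --> l i) ->
  (fun n => \sum_(i < m) v i n) @ \oo --> \sum_(i < m) l i.
Proof.
elim: m => [|m IH] vl.
  rewrite (_ : (fun n => _) = cst 0) ?big_ord0; first exact: cvg_cst.
  by apply/funext => n; rewrite big_ord0.
rewrite big_ord_recr (_ : (fun n => _) = fun n => \sum_(i < m) v i n + v m n).
  by apply: cvgD; [exact: IH|exact: vl].
by apply/funext => n; rewrite big_ord_recr.
Qed.

End RealSeries.

Section LimitForm.
Context {R : realType} {X : lmodType R[i]}.
Variables (w : nat -> X -> R[i]) (N : X -> R).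
Hypothesis wlin : forall k, scalar (w k).
Hypothesis wN : forall x, series (fun k => modulus (w k x) ^+ 2) @ \oo --> N x.

Let S n x y := \sum_(0 <= k < n) w k x * conjc (w k y).

Lemma sqr_form_norm_sum n x :
  form_norm (fun x y => \sum_(0 <= k < n) w k x * conjc (w k y)) x ^+ 2
  = \sum_(0 <= k < n) modulus (w k x) ^+ 2.
Proof.
rewrite (sqr_form_norm (psd_form_sum n wlin)).
elim: n => [|n IH]; first by rewrite !big_geq.
by rewrite !big_nat_recr//= ReD IH mulc_conj.
Qed.

Lemma form_polarization (B : X -> X -> R[i]) : psd_form B -> forall x y,
  Re (B x y) = (form_norm B (x + y) ^+ 2 - form_norm B (x - y) ^+ 2) / 4.
Proof.
move=> HB x y; rewrite !(sqr_form_normD HB) -scaleN1r (formZr HB) (form_normZ HB).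
have -> : modulus (-1 : R[i]) = 1 by rewrite normcN ComplexField.Normc.normc1.
by rewrite conjN conjc1 mulN1r ReN; field.
Qed.

Lemma form_Im (B : X -> X -> R[i]) : psd_form B -> forall x y,
  Im (B x y) = Re (B x ('i%C *: y)).
Proof.
by move=> HB x y; rewrite (formZr HB); case: (B x y) => a b /=; ring.
Qed.

Let B x y : R[i] := Complex ((N (x + y) - N (x - y)) / 4)
   ((N (x + 'i%C *: y) - N (x - 'i%C *: y)) / 4).

Let cvgRe x y : (fun n => Re (S n x y)) @ \oo --> Re (B x y).
Proof.
rewrite (_ : (fun n => _) = fun n =>
  (\sum_(0 <= k < n) modulus (w k (x + y)) ^+ 2 -
   \sum_(0 <= k < n) modulus (w k (x - y)) ^+ 2) / 4).
  by apply: cvgMl; apply: cvgB; exact: wN.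
apply/funext => n; rewrite (form_polarization (psd_form_sum n wlin)).
by rewrite !sqr_form_norm_sum.
Qed.

Let cvgIm x y : (fun n => Im (S n x y)) @ \oo --> Im (B x y).
Proof.
rewrite (_ : (fun n => _) = fun n => Re (S n x ('i%C *: y))).
  rewrite (_ : Im (B x y) = Re (B x ('i%C *: y)))//; exact: cvgRe.
by apply/funext => n; rewrite (form_Im (psd_form_sum n wlin)).
Qed.

Let eqB (z : R[i]) x y : (fun n => Re (S n x y)) @ \oo --> Re z ->
  (fun n => Im (S n x y)) @ \oo --> Im z -> B x y = z.
Proof.
move=> rz iz; apply/eqP; rewrite eq_complex; apply/andP; split; apply/eqP.
  exact: (cvg_unique _ (@cvgRe x y) rz).
exact: (cvg_unique _ (@cvgIm x y) iz).
Qed.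

(** Polarization turns a convergent sum of squared functionals into a form. *)
Lemma limit_form : exists2 B, psd_form B & forall x, form_norm B x ^+ 2 = N x.
Proof.
have BN x : Re (B x x) = N x.
  apply: (cvg_unique _ (@cvgRe x x)) => //.
  rewrite (_ : (fun n => _) = series (fun k => modulus (w k x) ^+ 2)); first exact: wN.
  apply/funext => n; rewrite -(sqr_form_norm (psd_form_sum n wlin)).
  by rewrite sqr_form_norm_sum.
have HB : psd_form B.
  split => [a x y z|x y|x].
  - apply: eqB.
      rewrite (_ : (fun n => _) = fun n =>
         Re a * Re (S n x z) - Im a * Im (S n x z) + Re (S n y z)).
        rewrite (_ : Re (_ + _) = Re a * Re (B x z) - Im a * Im (B x z) + Re (B y z)).
          apply: cvgD; last exact: cvgRe.
          by apply: cvgB; apply: cvgMr; [exact: cvgRe|exact: cvgIm].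
        by rewrite ReD; case: a (B x z) => ? ? [].
      apply/funext => n; rewrite /S (psd_lin (psd_form_sum n wlin)) ReD.
      by case: a (\sum_(0 <= k < n) w k x * _) => ? ? [].
    rewrite (_ : (fun n => _) = fun n =>
       Re a * Im (S n x z) + Im a * Re (S n x z) + Im (S n y z)).
      rewrite (_ : Im (_ + _) = Re a * Im (B x z) + Im a * Re (B x z) + Im (B y z)).
        apply: cvgD; last exact: cvgIm.
        by apply: cvgD; apply: cvgMr; [exact: cvgIm|exact: cvgRe].
      by case: a (B x z) (B y z) => ? ? [? ?] [].
    apply/funext => n; rewrite /S (psd_lin (psd_form_sum n wlin)).
    by case: a (\sum_(0 <= k < n) w k x * _) (\sum_(0 <= k < n) w k y * _) => ? ? [? ?] [].
  - apply: eqB.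
      rewrite (_ : (fun n => _) = fun n => Re (S n x y)).
        by rewrite (_ : Re (conjc _) = Re (B x y))//; case: (B x y).
      apply/funext => n; rewrite /S (psd_conj (psd_form_sum n wlin) x y).
    by case: (\sum_(_ <= _ < _) _).
    rewrite (_ : (fun n => _) = fun n => - Im (S n x y)).
      rewrite (_ : Im (conjc _) = - Im (B x y)); last by case: (B x y).
      by apply: cvgN; exact: cvgIm.
    apply/funext => n; rewrite /S (psd_conj (psd_form_sum n wlin) x y).
    by case: (\sum_(_ <= _ < _) _).
  - rewrite BN -(cvg_lim _ (wN (x:=x)))//; apply: limr_ge.
      by apply/cvg_ex; exists (N x).
    by near=> n; apply: sumr_ge0 => k _; rewrite sqr_ge0.
by exists B => // x; rewrite (sqr_form_norm HB) BN.
Unshelve. all: by end_near. Qed.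

End LimitForm.

(** * Finite-dimensional approximation through a Hilbert-Schmidt link *)

Section ScalarFunctionals.
Context {R : realType} {X : lmodType R[i]}.
Variable w : X -> R[i].
Hypothesis wl : scalar w.

Lemma scalar_fun0 : w 0 = 0.
Proof.
have := wl 1 0 0; rewrite scaler0 addr0 mul1r => /eqP.
by rewrite -subr_eq0 opprD addrA subrr sub0r oppr_eq0 => /eqP.
Qed.

Lemma scalar_funZ a x : w (a *: x) = a * w x.
Proof. by have := wl a x 0; rewrite !addr0 scalar_fun0 addr0. Qed.

Lemma scalar_funD x y : w (x + y) = w x + w y.
Proof. by have := wl 1 x y; rewrite scale1r mul1r. Qed.

Lemma scalar_fun_sum (I : Type) (r : seq I) (F : I -> X) :
  w (\sum_(i <- r) F i) = \sum_(i <- r) w (F i).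
Proof.
elim: r => [|i r IH]; first by rewrite !big_nil scalar_fun0.
by rewrite !big_cons scalar_funD IH.
Qed.

End ScalarFunctionals.

Section Span.
Context {R : realType} {X : lmodType R[i]}.
Implicit Types (L : seq X) (x y v : X).

(** The linear span, as the intersection of the subspaces containing [L]: its
    only use is that a subspace containing [L] contains the span. *)
Definition in_span L v := forall S : X -> Prop, S 0 ->
  (forall a x y, S x -> S y -> S (a *: x + y)) -> {in L, forall g, S g} -> S v.

Lemma in_span0 L : in_span L 0.
Proof. by move=> S S0 _ _. Qed.

Lemma in_spanP L a x y : in_span L x -> in_span L y -> in_span L (a *: x + y).
Proof. by move=> Lx Ly S S0 SP SL; exact: SP (Lx _ S0 SP SL) (Ly _ S0 SP SL). Qed.

Lemma in_spanD L x y : in_span L x -> in_span L y -> in_span L (x + y).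
Proof. by move=> Lx Ly; rewrite -[x]scale1r; exact: in_spanP. Qed.

Lemma sub_in_span L1 L2 v : {subset L1 <= L2} -> in_span L1 v -> in_span L2 v.
Proof. by move=> L12 Lv S S0 SP SL; apply: Lv => // g /L12; exact: SL. Qed.

Lemma in_span_sum L (n : nat) (c : nat -> R[i]) (e : nat -> X) :
  (forall i, (i < n)%N -> e i \in L) ->
  in_span L (\sum_(i < n) c i *: e i).
Proof.
elim: n => [|n IH] eL; first by rewrite big_ord0; exact: in_span0.
rewrite big_ord_recr /= addrC; apply: in_spanP; last by apply: IH => i /ltnW/eL.
by move=> S _ _; apply; exact: eL.
Qed.

End Span.

Section Greedy.
Context {R : realType} {X : lmodType R[i]}.
Variables (B B' : X -> X -> R[i]) (w : nat -> X -> R[i]) (g : nat -> R) (S : R).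
Hypotheses (HB : psd_form B) (HB' : psd_form B').
Hypothesis le_norm : forall x, form_norm B' x <= form_norm B x.
Hypothesis wl : forall n, scalar (w n).
Hypothesis wg : forall n x, modulus (w n x) <= g n * form_norm B x.
Hypothesis w_norm : forall x,
  series (fun n => modulus (w n x) ^+ 2) @ \oo --> form_norm B' x ^+ 2.
Hypothesis gS : forall n, \sum_(0 <= k < n) g k ^+ 2 <= S.

Local Notation h := (form_norm B).
Local Notation h' := (form_norm B').

Definition orthonormal_seq n (e : nat -> X) :=
  forall i j, (i < n)%N -> (j < n)%N -> B (e i) (e j) = (i == j)%:R.

(** The bound is tested on [\sum_i conjc (u (e i)) *: e i]. *)
Lemma bessel n e (u : X -> R[i]) (c : R) : orthonormal_seq n e -> scalar u ->
  (forall x, modulus (u x) <= c * h x) ->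
  \sum_(i < n) modulus (u (e i)) ^+ 2 <= c ^+ 2.
Proof.
move=> eo ul uc; set T := \sum_(i < n) _.
have T0 : 0 <= T by apply: sumr_ge0 => i _; exact: sqr_ge0.
pose v := \sum_(i < n) conjc (u (e i)) *: e i.
have uv : u v = T%:C%C.
  rewrite scalar_fun_sum// rmorph_sum; apply: eq_bigr => i _.
  by rewrite scalar_funZ// mulrC mulc_conj.
have hv : h v ^+ 2 = T.
  rewrite sqr_form_norm// /v form_suml//.
  rewrite (eq_bigr (fun i : 'I_n => (modulus (u (e i)) ^+ 2)%:C%C)).
    by rewrite -[RHS]/(Re T%:C%C) /T rmorph_sum.
  move=> i _; rewrite formZl// form_sumr// (bigD1 i)//= big1 => [|j ji].
    by rewrite addr0 formZr// eo// eqxx mulr1 conjcK mulrC mulc_conj.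
  by rewrite formZr// eo// eq_sym (inj_eq val_inj) (negbTE ji) mulr0.
have := uc v; rewrite uv modulus_real ger0_norm// => Tc.
have [->|Tn0] := eqVneq T 0; first exact: sqr_ge0.
have Tp : 0 < T by rewrite lt_neqAle eq_sym Tn0.
rewrite -(ler_pM2r Tp) -expr2 -[X in _ <= _ * X]hv -exprMn.
by rewrite lerXn2r// nnegrE (le_trans T0 Tc).
Qed.

Let residual n (e : nat -> X) x := x - \sum_(i < n) B x (e i) *: e i.

Let residual_orth n e x j : orthonormal_seq n e -> (j < n)%N ->
  B (residual n e x) (e j) = 0.
Proof.
move=> eo jn; rewrite formBl// form_suml// (bigD1 (Ordinal jn))//= big1.
  by rewrite addr0 formZl// eo// eqxx mulr1 subrr.
move=> i ij; rewrite formZl// eo//.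
by rewrite -[j]/(val (Ordinal jn)) (inj_eq val_inj) (negbTE ij) mulr0.
Qed.

Let residual_le n e x : orthonormal_seq n e -> h (residual n e x) <= h x.
Proof.
move=> eo; rewrite -(ler_pXn2r (ltn0Sn 1)) ?nnegrE ?form_norm_ge0//.
rewrite -[in leRHS](subrK (\sum_(i < n) B x (e i) *: e i) x) -/(residual n e x).
rewrite [leRHS](sqr_form_normD HB) (form_sumr HB) big1 ?mulr0 ?addr0 ?lerDl ?sqr_ge0//.
by move=> i _; rewrite formZr// residual_orth// mulr0.
Qed.

(** As long as some residual is badly approximated, normalizing it yields one
    more orthonormal vector on which [h'] is large. *)
Lemma greedy_dichotomy (eps : R) n : 0 <= eps ->
  (exists L : seq X, (size L <= n)%N /\
     forall x, exists2 v, in_span L v & h' (x - v) <= eps * h x) \/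
  (exists2 e, orthonormal_seq n e & forall i, (i < n)%N -> eps < h' (e i)).
Proof.
move=> eps0; elim: n => [|n [[L [Ln LP]]|[e eo eh]]].
- by right; exists (fun=> 0).
- by left; exists L; split => //; exact: leqW.
- have [[y hy]|bad] := pselect (exists y, eps * h (residual n e y) < h' (residual n e y)).
    right; set z := residual n e y in hy.
    have hz : 0 < h z.
      rewrite lt_neqAle form_norm_ge0 andbT; apply/eqP => hz.
      by have := le_norm z; rewrite leNgt -hz (le_lt_trans _ hy)// -hz mulr0.
    pose en := ((h z)^-1)%:C%C *: z.
    have mod_hz : modulus ((h z)^-1)%:C%C = (h z)^-1.
      by rewrite modulus_real ger0_norm// invr_ge0 ltW.
    have orth j : (j < n)%N -> B en (e j) = 0.
      by move=> jn; rewrite formZl// residual_orth// mulr0.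
    have unit : B en en = 1.
      by rewrite form_diag// form_normZ// mod_hz mulVf ?gt_eqF// expr1n.
    exists (fun i => if (i < n)%N then e i else en).
      move=> i j; rewrite !ltnS (leq_eqVlt i) (leq_eqVlt j) => /predU1P[->|ilt] /predU1P[->|jlt].
      - by rewrite ltnn eqxx.
      - by rewrite ltnn jlt orth// gtn_eqF.
      - by rewrite ltnn ilt (psd_conj HB) orth// conjc0 ltn_eqF.
      - by rewrite ilt jlt eo.
    move=> i; rewrite ltnS leq_eqVlt => /predU1P[->|ilt]; last by rewrite ilt eh.
    by rewrite ltnn form_normZ// mod_hz mulrC ltr_pdivlMr.
  left; exists (map e (iota 0 n)); split; first by rewrite size_map size_iota.
  move=> x; exists (\sum_(i < n) B x (e i) *: e i).
    apply: (@in_span_sum _ _ _ n (fun i => B x (e i)) e) => i ilt.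
    by apply: map_f; rewrite mem_iota.
  apply: (@le_trans _ _ (eps * h (residual n e x))).
    by rewrite leNgt; apply/negP => lt; apply: bad; exists x.
  by rewrite ler_wpM2l// residual_le.
Qed.

(** Each greedy step adds more than [(C / N) ^+ 2] to [\sum_i h' (e i) ^+ 2],
    which is at most [S] by Bessel's inequality applied to each [w k]: the
    process stops within [N ^ 2] steps if [C ^+ 2] exceeds [S]. *)
Lemma hilbert_schmidt_approx : exists2 C : R, 0 < C & forall N : nat,
  exists L : seq X, (size L <= N.+1 ^ 2)%N /\
    forall x, exists2 v, in_span L v & h' (x - v) <= C / N.+1%:R * h x.
Proof.
have S0 : 0 <= S by have := gS 0; rewrite big_geq.
exists (S + 1) => [|N]; first by rewrite ltr_wpDl.
have eps0 : 0 <= (S + 1) / N.+1%:R by rewrite divr_ge0// addr_ge0.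
have [//|[e eo eh]] := greedy_dichotomy (N.+1 ^ 2) eps0.
exfalso.
have upper : \sum_(i < N.+1 ^ 2) h' (e i) ^+ 2 <= S.
  apply: (@cvgn_le_bound _
    (fun n => \sum_(i < N.+1 ^ 2) series (fun k => modulus (w k (e i)) ^+ 2) n)).
    apply: (@sum_cvgn _ (fun i n => series (fun k => modulus (w k (e i)) ^+ 2) n)
      (fun i => h' (e i) ^+ 2)) => i.
    exact: w_norm.
  move=> n; rewrite /series /= exchange_big /=.
  apply: le_trans (gS n); apply: ler_sum => k _.
  exact: bessel eo (wl k) (wg k).
have lower : (S + 1) ^+ 2 < \sum_(i < N.+1 ^ 2) h' (e i) ^+ 2.
  have -> : (S + 1) ^+ 2 = \sum_(i < N.+1 ^ 2) ((S + 1) / N.+1%:R) ^+ 2.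
    rewrite sumr_const card_ord -[RHS]mulr_natr natrX expr_div_n divfK//.
  have pos : (0 < N.+1 ^ 2)%N by rewrite expn_gt0.
  rewrite (bigD1 (Ordinal pos))//= [ltRHS](bigD1 (Ordinal pos))//=.
  apply: ltr_leD; last apply: ler_sum => i _.
    by rewrite ltrXn2r// ?nnegrE ?form_norm_ge0// eh.
  by rewrite lerXn2r// ?nnegrE ?form_norm_ge0// ltW// eh.
have := lt_le_trans lower upper; nra.
Qed.

End Greedy.

(** * Rapidly decreasing coordinates *)

(** A pairing with polynomial bounds, so that rapid decay in two indices is the
    same as rapid decay in the paired index. *)
Definition pairn (a b : nat) := ((a + b) ^ 2 + b)%N.

(** Total, hence only a left inverse of [pairn]; what matters is that every
    pair is reached and that an index is polynomially bounded by its pair. *)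
Definition unpair (j : nat) : nat * nat :=
  let m := PeanoNat.Nat.sqrt j in let i := (j - m ^ 2)%N in (m - i, i)%N.

Lemma pairnK a b : unpair (pairn a b) = (a, b).
Proof.
rewrite /unpair /pairn.
have -> : PeanoNat.Nat.sqrt ((a + b) ^ 2 + b) = (a + b)%N.
  by apply: PeanoNat.Nat.sqrt_unique; split; nia.
by rewrite addKn addnK.
Qed.

Lemma unpair_bound j :
  (j.+1 <= ((unpair j).1 + (unpair j).2).+1 ^ 2)%N.
Proof.
rewrite /unpair /=; have := PeanoNat.Nat.sqrt_spec j (PeanoNat.Nat.le_0_l j).
set m := PeanoNat.Nat.sqrt j => -[m1 m2].
have : (m ^ 2 <= j)%N by nia.
move=> {}m1; have : (j < m.+1 ^ 2)%N by nia.
move=> {}m2; have : (m <= m - (j - m ^ 2) + (j - m ^ 2))%N by lia.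
move=> mle; apply: (leq_trans m2); by rewrite leq_exp2r.
Qed.

Section GramSchmidt.
Context {R : realType} {X : lmodType R[i]}.
Variables (B : X -> X -> R[i]) (g : nat -> X).
Hypothesis HB : psd_form B.
Local Notation h := (form_norm B).

Definition normalized x : X := (h x)^-1%:C%C *: x.

Lemma form_normalized x : B x (normalized x) = (h x)%:C%C.
Proof.
rewrite formZr// form_diag// conjc_real -realM.
have [->|hn0] := eqVneq (h x) 0; first by rewrite invr0 mul0r.
by rewrite expr2 mulKf.
Qed.

Lemma norm_normalized_le1 x : h (normalized x) <= 1.
Proof.
rewrite form_normZ// modulus_real ger0_norm ?invr_ge0 ?form_norm_ge0//.
by have [->|hn0] := eqVneq (h x) 0; rewrite ?mulr0// mulVf.
Qed.

Lemma normalized_projection x y (e := normalized y) :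
  h (x - B x e *: e) ^+ 2 = h x ^+ 2 - modulus (B x e) ^+ 2.
Proof.
have [he|he] : e = 0 \/ h e = 1.
  rewrite /e /normalized; have [->|hn0] := eqVneq (h y) 0.
    by left; rewrite invr0 scale0r.
  right; rewrite form_normZ// modulus_real ger0_norm ?invr_ge0 ?form_norm_ge0//.
  by rewrite mulVf.
  by rewrite he scaler0 subr0 form0r// ComplexField.Normc.normc0 expr0n subr0.
rewrite -scaleNr sqr_form_normD// formZr// form_normZ// he mulr1 normcN.
rewrite conjN mulNr [conjc _ * _]mulrC mulc_conj ReN /=; lra.
Qed.

(** The Gram-Schmidt process as a sequence of operators: [residual n] removes
    the component along the first [n] vectors of [g]. *)
Fixpoint residual n x : X :=
  if n is m.+1 then
    residual m x - B (residual m x) (normalized (residual m (g m)))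
                   *: normalized (residual m (g m))
  else x.

Definition coordinate n x := B (residual n x) (normalized (residual n (g n))).

Lemma residualP n a x y :
  residual n (a *: x + y) = a *: residual n x + residual n y.
Proof.
elim: n => //= n IH; rewrite IH (psd_lin HB) scalerDl -scalerA scalerBr.
by rewrite opprD addrACA.
Qed.

Lemma coordinate_scalar n : scalar (coordinate n).
Proof. by move=> a x y; rewrite /coordinate residualP (psd_lin HB). Qed.

Lemma residual_parseval n x :
  \sum_(0 <= k < n) modulus (coordinate k x) ^+ 2 = h x ^+ 2 - h (residual n x) ^+ 2.
Proof.
elim: n => [|n IH]; first by rewrite big_geq//= subrr.
by rewrite big_nat_recr//= IH normalized_projection -/(coordinate n x); ring.
Qed.

Lemma residualS_le n x : h (residual n.+1 x) <= h (residual n x).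
Proof.
rewrite -(ler_pXn2r (ltn0Sn 1)) ?nnegrE ?form_norm_ge0//.
by rewrite /= normalized_projection gerBl sqr_ge0.
Qed.

Lemma residual_le n x : h (residual n x) <= h x.
Proof. by elim: n => // n; exact: le_trans (residualS_le n x). Qed.

Lemma residual_kill n i : (i < n)%N -> h (residual n (g i)) = 0.
Proof.
move=> /subnK <-; elim: (n - i.+1)%N => [|k IH].
  rewrite add0n; apply/eqP; rewrite -sqrf_eq0 /= normalized_projection.
  rewrite form_normalized modulus_real ger0_norm ?form_norm_ge0//.
  by rewrite subrr.
apply/eqP; rewrite eq_le form_norm_ge0 andbT -IH.
exact: residualS_le.
Qed.

Lemma residual_span n v : in_span [seq g i | i <- iota 0 n] v ->
  h (residual n v) = 0.
Proof.
move=> gv; apply: (gv (fun v => h (residual n v) = 0)) => [|a x y hx hy|_ /mapP[i + ->]].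
- have := residualP n 0 0 0; rewrite !scale0r !add0r => ->.
  by apply/eqP; rewrite eq_le form_norm_ge0 andbT (le_trans (residual_le _ _))//
     /form_norm form0l//= sqrtr0.
- apply/eqP; rewrite eq_le form_norm_ge0 andbT residualP.
  by rewrite (le_trans (form_normD HB _ _))// form_normZ// hx hy mulr0 addr0.
- by rewrite mem_iota => /andP[_]; exact: residual_kill.
Qed.

Lemma coordinate_le n x v : in_span [seq g i | i <- iota 0 n] v ->
  h (residual n x) <= h (x - v) /\ modulus (coordinate n x) <= h (x - v).
Proof.
move=> gv; have le1 : h (residual n x) <= h (x - v).
  have -> : residual n x = residual n (x - v) + residual n v.
    by rewrite -[residual n (x - v)]scale1r -residualP scale1r subrK.
  apply: le_trans (form_normD HB _ _) _; rewrite (residual_span gv) addr0.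
  exact: residual_le.
split => //; apply: le_trans (form_cauchy_schwarz HB _ _) _.
apply: le_trans le1; rewrite -[leRHS]mulr1 ler_wpM2l ?form_norm_ge0//.
exact: norm_normalized_le1.
Qed.

End GramSchmidt.

(** The map between the local Hilbert spaces of [B] and [B'] is a Hilbert-Schmidt
    operator; the [w n] are its coordinates. *)
Definition hs_link {R : realType} {X : lmodType R[i]} (B' B : X -> X -> R[i]) :=
  exists (w : nat -> X -> R[i]) (g : nat -> R) (S : R),
  [/\ forall n, scalar (w n),
      forall n x, modulus (w n x) <= g n * form_norm B x,
      forall x, series (fun n => modulus (w n x) ^+ 2) @ \oo --> form_norm B' x ^+ 2
    & forall n, \sum_(0 <= k < n) g k ^+ 2 <= S].

Section HilbertScale.
Context {R : realType} {X : lmodType R[i]}.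
Variable B : nat -> X -> X -> R[i].
Hypothesis HB : forall k, psd_form (B k).
Local Notation h k := (form_norm (B k)).
Hypothesis h_mono : forall k x, h k x <= h k.+1 x.
Hypothesis h_link : forall k, hs_link (B k) (B k.+1).

Lemma scale_mono k l x : (k <= l)%N -> h k x <= h l x.
Proof.
move=> /subnK <-; elim: (l - k)%N => // m IH.
by rewrite addSn (le_trans IH).
Qed.

(** Approximations through the successive links are applied to one another's
    residuals, so that their rates multiply and their sizes add. *)
Lemma scale_approx q r : exists2 C : R, 0 < C & forall N : nat,
  exists L : seq X, (size L <= r * N.+1 ^ 2)%N /\
  forall x, exists2 v, in_span L v &
    h q (x - v) <= C / N.+1%:R ^+ r * h (q + r) x.
Proof.
elim: r => [|r [C C0 CP]].
  exists 1 => // N; exists [::]; split => // x; exists 0; first exact: in_span0.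
  by rewrite subr0 expr0 divr1 mul1r addn0.
have [w [g [S [wl wg wn gS]]]] := h_link (q + r).
have [D D0 DP] := hilbert_schmidt_approx (HB (q + r).+1) (HB (q + r))
  (h_mono (q + r)) wl wg wn gS.
exists (C * D) => [|N]; first exact: mulr_gt0.
have [L1 [s1 a1]] := CP N; have [L2 [s2 a2]] := DP N.
exists (L1 ++ L2); split; first by rewrite size_cat mulSn addnC leq_add.
move=> x; have [v2 Lv2 hv2] := a2 x; have [v1 Lv1 hv1] := a1 (x - v2).
exists (v2 + v1).
  by apply: in_spanD; [apply: sub_in_span Lv2|apply: sub_in_span Lv1] => y yL;
    rewrite mem_cat yL ?orbT.
rewrite opprD addrA (le_trans hv1)// addnS.
apply: le_trans (ler_wpM2l _ hv2) _; first by rewrite divr_ge0 ?exprn_ge0 ?ltW.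
rewrite mulrA ler_wpM2r ?form_norm_ge0// exprSr invfM.
by apply: le_of_eq; ring.
Qed.

Lemma nat_root8 n : exists M, ((2 * M) ^ 8 <= n < (2 * M.+1) ^ 8)%N.
Proof.
elim: n => [|n [M /andP[lo hi]]]; first by exists 0.
have [lt|ge] := ltnP n.+1 ((2 * M.+1) ^ 8).
  by exists M; rewrite lt (leq_trans lo).
exists M.+1; rewrite ge /= (leq_ltn_trans hi)// ltn_exp2r// ltn_pmul2l//.
Qed.

(** A single sequence whose initial segments approximate the space in [h q]
    faster than every power: enumerate the union, over [m], of the sets that
    provide the rates [0 .. m] at level [m]; it has polynomial size in [m]. *)
Lemma fast_approximating_sequence q : exists g : nat -> X, forall K,
  exists (C : R) (r : nat), 0 < C /\ forall n x,
  exists2 v, in_span [seq g i | i <- iota 0 n] v &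
    h q (x - v) <= C / n.+1%:R ^+ K * h r x.
Proof.
have /choice[C CP] : forall r, exists C : R, 0 < C /\ forall N : nat,
  exists L : seq X, (size L <= r * N.+1 ^ 2)%N /\
  forall x, exists2 v, in_span L v &
    h q (x - v) <= C / N.+1%:R ^+ r * h (q + r) x.
  by move=> r; have [C ? ?] := scale_approx q r; exists C.
have /choice[L0 L0P] : forall rN : nat * nat, exists L : seq X,
  (size L <= rN.1 * rN.2.+1 ^ 2)%N /\
  forall x, exists2 v, in_span L v &
    h q (x - v) <= C rN.1 / rN.2.+1%:R ^+ rN.1 * h (q + rN.1) x.
  by move=> [r N]; have [_ /(_ N)] := CP r.
pose L m := flatten [seq L0 (r, m) | r <- iota 0 m.+1].
have sizeL m : (size (L m) <= m.+1 ^ 4)%N.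
  rewrite /L size_flatten /shape -map_comp sumnE big_map.
  apply: (@leq_trans (\sum_(r <- iota 0 m.+1) m.+1 ^ 3)).
    rewrite big_seq [X in (_ <= X)%N]big_seq; apply: leq_sum => r.
    rewrite mem_iota add0n => /andP[_ rm].
    apply: leq_trans (L0P (r, m)).1 _ => /=; rewrite [(_ ^ 3)%N]expnS.
    by rewrite leq_mul2r ltnW ?orbT.
  by rewrite big_const_seq count_predT size_iota iter_addn_0 -expnSr.
pose g j := nth 0 (L (unpair j).1) (unpair j).2.
have gL m n : ((2 * m.+1) ^ 8 <= n)%N -> {subset L m <= [seq g i | i <- iota 0 n]}.
  move=> mn y yL; pose b := index y (L m).
  have bs : (b < m.+1 ^ 4)%N by rewrite (leq_trans _ (sizeL m))// index_mem.
  apply/mapP; exists (pairn m b); last by rewrite /g pairnK nth_index.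
  (* The level [m] holds at most [m.+1 ^ 4] vectors and the pairing squares: hence
     the exponent 8. *)
  rewrite mem_iota add0n /=; apply: leq_trans mn; rewrite /pairn.
  have le1 : (m + b < 2 * m.+1 ^ 4)%N.
    by have : (m < m.+1 ^ 4)%N; [rewrite -[X in (X <= _)%N]expn1 leq_pexp2l|lia].
  apply: (@leq_trans ((2 * m.+1 ^ 4) ^ 2)%N).
    apply: (@leq_trans ((m + b).+1 ^ 2)%N); [nia|by rewrite leq_exp2r].
  rewrite (expnMn 2 (m.+1 ^ 4)) (expnMn 2 m.+1) -expnM leq_mul2r; apply/orP; right.
  by rewrite leq_exp2l.
exists g => K; pose M0 := (8 * K)%N; pose n0 := ((2 * M0.+1) ^ 8)%N.
have [CM0 _] := CP M0.
have cst0 : 0 <= (n0.+1%:R : R) ^+ K by rewrite exprn_ge0.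
have cst1 : 0 < 4 ^+ M0 * C M0 by rewrite mulr_gt0// exprn_gt0.
exists (n0.+1%:R ^+ K + 4 ^+ M0 * C M0), (q + M0)%N; split; first by lra.
move=> n x; have hx0 := form_norm_ge0 (B (q + M0)) x.
have nK : 0 < (n.+1%:R : R) ^+ K by rewrite exprn_gt0.
(* Level [m] provides the rate [M0] only if [M0 <= m], that is for large [n]. *)
have [small|large] := ltnP n n0.
  exists 0; first exact: in_span0.
  rewrite subr0; apply: le_trans (scale_mono x (leq_addr M0 q)) _.
  rewrite -[leLHS]mul1r ler_wpM2r// ler_pdivlMr// mul1r.
  apply: (@le_trans _ _ (n0.+1%:R ^+ K)); last by rewrite lerDl ltW.
  by rewrite lerXn2r ?nnegrE// ler_nat ltnW// ltnS.
have [[|m] /andP[lo hi]] := nat_root8 n.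
  suff : (n < n0)%N by rewrite ltnNge large.
  by apply: leq_trans hi _; rewrite /n0 leq_exp2r// leq_mul2l/=.
have mM0 : (M0 <= m)%N.
  rewrite leqNgt; apply/negP => mM; suff : (n < n0)%N by rewrite ltnNge large.
  by apply: leq_trans hi _; rewrite /n0 leq_exp2r// leq_mul2l/= ltnS.
have [_ /(_ x)[v Lv hv]] := L0P (M0, m).
exists v.
  apply: sub_in_span Lv => y yL; apply: (gL m n lo); apply/flattenP.
  exists (L0 (M0, m)) => //; apply/mapP; exists M0 => //.
  by rewrite mem_iota add0n ltnS.
apply: le_trans hv _; rewrite ler_wpM2r//.
have mM : 0 < (m.+1%:R : R) ^+ M0 by rewrite exprn_gt0.
rewrite ler_pdivrMr//= mulrAC ler_pdivlMr//.
apply: (@le_trans _ _ (C M0 * (4 ^+ M0 * m.+1%:R ^+ M0))); last first.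
  by rewrite mulrA [C M0 * _]mulrC ler_wpM2r ?lerDr// ltW.
rewrite ler_wpM2l ?(ltW CM0)//= -exprMn -natrM -!natrX ler_nat /M0 expnM.
have [->|K0] := posnP K; first by rewrite !expn0.
by rewrite leq_exp2r// (leq_trans hi)// leq_exp2r//; lia.
Qed.

(** Coordinates for a form dominated by the scale: Gram-Schmidt along a fast
    approximating sequence, since each coordinate is bounded by the distance
    to the span of the preceding vectors. *)
Lemma fast_coordinates (B' : X -> X -> R[i]) (c : R) (q : nat) : psd_form B' ->
  0 <= c -> (forall x, form_norm B' x <= c * h q x) ->
  exists y : nat -> X -> R[i],
  [/\ forall n, scalar (y n),
      forall x, series (fun n => modulus (y n x) ^+ 2) @ \oo --> form_norm B' x ^+ 2
    & forall K, exists (C : R) (r : nat), 0 < C /\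
        forall n x, modulus (y n x) <= C / n.+1%:R ^+ K * h r x].
Proof.
move=> HB' c0 le_c; have [g gP] := fast_approximating_sequence q.
have main K : exists (C : R) (r : nat), 0 < C /\ forall n x,
    form_norm B' (residual B' g n x) <= C / n.+1%:R ^+ K * h r x /\
    modulus (coordinate B' g n x) <= C / n.+1%:R ^+ K * h r x.
  have [C [r [C0 CP]]] := gP K; exists ((c + 1) * C), r.
  split=> [|n x]; first by rewrite mulr_gt0// ltr_wpDl.
  have [v gv hv] := CP n x; have [l1 l2] := coordinate_le HB' x gv.
  have le3 : form_norm B' (x - v) <= (c + 1) * C / n.+1%:R ^+ K * h r x.
    apply: le_trans (le_c _) _; rewrite -!mulrA in hv *; apply: ler_pM => //.
      exact: form_norm_ge0.
    by rewrite lerDl.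
  by split; [exact: le_trans l1 le3|exact: le_trans l2 le3].
exists (coordinate B' g); split=> [n|x|K].
- exact: coordinate_scalar.
- rewrite (_ : series _ = fun n => form_norm B' x ^+ 2 - form_norm B' (residual B' g n x) ^+ 2).
    rewrite -[X in _ --> X]subr0; apply: cvgB; first exact: cvg_cst.
    have [C [r [C0 CP]]] := main 1.
    have res0 : (fun n => form_norm B' (residual B' g n x)) @ \oo --> (0 : R).
      apply: (@squeeze_cvgr _ _ _ _ (cst 0) (fun n => C * h r x * n.+1%:R^-1)).
      + near=> n; rewrite form_norm_ge0 /=; have [+ _] := CP n x.
        by rewrite expr1 mulrAC.
      + exact: cvg_cst.
      + rewrite -[X in _ --> X](mulr0 (C * h r x)); apply: cvgMr.
        exact: cvg_harmonic.
    rewrite (_ : (fun n => _) = fun n =>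
        form_norm B' (residual B' g n x) * form_norm B' (residual B' g n x)).
      by rewrite -[X in _ --> X](mulr0 0); apply: cvgM.
    by apply/funext => n; rewrite expr2.
  by apply/funext => n; rewrite /series /= residual_parseval.
- have [C [r [C0 CP]]] := main K; exists C, r; split => // n x.
  by have [] := CP n x.
Unshelve. all: by end_near. Qed.

End HilbertScale.

(** * Functionals in a scale with a dominating norm *)

Lemma sum_geometric_half_le (R : realType) m n :
  \sum_(m <= i < n) (2 ^- i : R) <= 2.
Proof.
have [mn|nm] := leqP m n; last by rewrite big_geq// ltnW.
have full : \sum_(0 <= i < n) (2 ^- i : R) <= 2.
  suff -> : \sum_(0 <= i < n) (2 ^- i : R) = 2 - 2 * 2 ^- n by rewrite gerBl mulr_ge0.
  elim: n {mn} => [|n IH]; first by rewrite big_geq// expr0 invr1 mulr1 subrr.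
  by rewrite big_nat_recr//= IH exprS; field; rewrite expf_neq0.
apply: le_trans full; rewrite [leRHS](big_cat_nat (leq0n m) mn)/=.
by rewrite lerDr sumr_ge0.
Qed.

Lemma scalar_form_left {R : realType} {X : lmodType R[i]} (f : X -> X -> R[i]) z :
  psd_form f -> scalar (fun x => f x z).
Proof. by move=> Hf a x y; rewrite (psd_lin Hf). Qed.

Lemma index_bound j (q := (unpair j).1) (e := unpair (unpair j).2) :
  (j.+1 <= q.+1 ^ 2 * (e.1.+1 * e.2.+1) ^ 4)%N.
Proof.
apply: leq_trans (unpair_bound j) _; rewrite -/q.
have := unpair_bound (unpair j).2; rewrite -/e; set i := (unpair j).2 => ei.
set w := (e.1.+1 * e.2.+1)%N.
have ew : (i.+1 <= w ^ 2)%N by apply: leq_trans ei _; rewrite leq_exp2r// /w; nia.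
rewrite (expnM w 2 2) -expnMn leq_exp2r//.
apply: (@leq_trans (q.+1 * i.+1)%N); first by nia.
by rewrite leq_mul2l ew orbT.
Qed.

Lemma pairn_ge q n t : (n.+1 * t.+1 <= (pairn q (pairn n t)).+1 ^ 2)%N.
Proof.
rewrite -[(_ ^ 2)%N]mulnn; apply: leq_mul; rewrite ltnS /pairn.
  by apply: (@leq_trans ((n + t) ^ 2)%N); nia.
by apply: (@leq_trans ((n + t) ^ 2 + t)%N); nia.
Qed.

Lemma interleaved_sum (R : realType) (u v : nat -> R) n :
  \sum_(0 <= j < n.*2) (if odd j then u j./2 else v j./2) =
  \sum_(0 <= j < n) v j + \sum_(0 <= j < n) u j.
Proof.
elim: n => [|n IH]; first by rewrite !big_geq// addr0.
rewrite doubleS !big_nat_recr//= IH /= odd_double /= doubleK uphalf_double; ring.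
Qed.

Section DominatingScale.
Context {R : realType} {X : lmodType R[i]}.
Variables (B : nat -> X -> X -> R[i]) (f : X -> X -> R[i]).
Hypothesis HB : forall k, psd_form (B k).
Hypothesis Hf : psd_form f.
Local Notation h k := (form_norm (B k)).
Local Notation nrm := (form_norm f).
Hypothesis h_mono : forall k x, h k x <= h k.+1 x.
Hypothesis h_link : forall k, hs_link (B k) (B k.+1).
Hypothesis nrm_le : forall x, nrm x <= h 0 x.
Hypothesis h_dominating : forall k x, h k x ^+ 2 <= nrm x * h k.+1 x.

Let hge0 k x : 0 <= h k x := form_norm_ge0 (B k) x.
Let nge0 x : 0 <= nrm x := form_norm_ge0 f x.
Let h_le := scale_mono h_mono.

Let nrm_leh k x : nrm x <= h k x.
Proof. exact: le_trans (nrm_le x) (h_le x (leq0n k)). Qed.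

(** The domination inequality in dual form.  The functional is bounded for the
    norm of [t ^+ 2 * f + t ^- 2 * B q.+1]; of its (approximate) representation
    for that form the first half is kept and the second half is the error. *)
Lemma dual_splitting (y : X -> R[i]) (q : nat) (A t : R) : scalar y ->
  0 < A -> 0 < t -> (forall x, modulus (y x) <= A * h q x) ->
  exists2 z, nrm z <= 2 * A * t &
    forall x, modulus (y x - f x z) <= 3 * A / t * h q.+1 x.
Proof.
move=> ys A0 t0 yA.
pose b x x' := (t ^+ 2)%:C%C * f x x' + (t ^- 2)%:C%C * B q.+1 x x'.
have Hb : psd_form b.
  by apply: psd_form_add; apply: psd_form_scale => //; rewrite ?invr_ge0 ?sqr_ge0.
have sqr_b x : form_norm b x ^+ 2 = t ^+ 2 * nrm x ^+ 2 + t ^- 2 * h q.+1 x ^+ 2.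
  by rewrite (sqr_form_norm Hb) /b (form_diag Hf) (form_diag (HB q.+1)) -!realM.
have b0 x := form_norm_ge0 b x.
have le_b1 x : t * nrm x <= form_norm b x.
  rewrite -(ler_pXn2r (ltn0Sn 1)) ?nnegrE ?b0 ?mulr_ge0 ?(ltW t0)//.
  by rewrite sqr_b exprMn lerDl mulr_ge0 ?invr_ge0 ?sqr_ge0.
have le_b2 x : t^-1 * h q.+1 x <= form_norm b x.
  rewrite -(ler_pXn2r (ltn0Sn 1)) ?nnegrE ?b0 ?mulr_ge0 ?invr_ge0 ?(ltW t0)//.
  by rewrite sqr_b exprMn exprVn lerDr mulr_ge0 ?sqr_ge0.
have b_le x : form_norm b x <= t * nrm x + t^-1 * h q.+1 x.
  have p1 : 0 <= t * nrm x by rewrite mulr_ge0 ?(ltW t0).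
  have p2 : 0 <= t^-1 * h q.+1 x by rewrite mulr_ge0 ?invr_ge0 ?(ltW t0).
  rewrite -(ler_pXn2r (ltn0Sn 1)) ?nnegrE ?b0 ?addr_ge0//.
  rewrite sqr_b -exprVn -!exprMn sqrrD -addrA lerD2l lerDr mulrn_wge0// mulr_ge0//.
have yb x : modulus (y x) <= A * form_norm b x.
  apply: le_trans (yA x) _; rewrite ler_wpM2l ?(ltW A0)//.
  rewrite -(ler_pXn2r (ltn0Sn 1)) ?nnegrE ?b0// sqr_b.
  apply: le_trans (h_dominating q x) _.
  have -> : nrm x * h q.+1 x = (t * nrm x) * (t^-1 * h q.+1 x).
    by rewrite mulrACA mulfV ?gt_eqF// mul1r.
  rewrite -exprVn -!exprMn; move: (t * _) (t^-1 * _) => u v.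
  by have := sqr_ge0 (u - v); have := sqr_ge0 u; have := sqr_ge0 v; rewrite sqrrB; lra.
have t21 : 0 < 1 + t ^+ 2 by rewrite ltr_wpDr ?sqr_ge0.
have e0 : 0 < A / (1 + t ^+ 2) by rewrite divr_gt0.
have eA : A / (1 + t ^+ 2) <= A.
  by rewrite ler_pdivrMr// ler_peMr ?(ltW A0)// lerDl sqr_ge0.
have [z hz] := approximate_riesz Hb ys yb e0.
have bz : form_norm b z <= 2 * A.
  apply: le_of_sqr_le_mul; rewrite ?form_norm_ge0 ?mulr_ge0 ?(ltW A0)//.
  have -> : form_norm b z ^+ 2 = modulus (b z z).
    by rewrite (form_diag Hb) modulus_real ger0_norm ?sqr_ge0.
  have -> : b z z = y z - (y z - b z z) by rewrite subKr.
  apply: le_trans (le_normcD _ _) _; rewrite normcN.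
  apply: le_trans (lerD (yb z) (hz z)) _.
  by rewrite -mulrDl ler_wpM2r//; lra.
exists ((t ^+ 2)%:C%C *: z) => [|x].
  rewrite form_normZ// modulus_real ger0_norm ?sqr_ge0//.
  have -> : t ^+ 2 * nrm z = t * nrm z * t by ring.
  by rewrite ler_wpM2r ?(ltW t0)// (le_trans (le_b1 z)).
have -> : y x - f x ((t ^+ 2)%:C%C *: z) = (y x - b x z) + (t ^- 2)%:C%C * B q.+1 x z.
  by rewrite (formZr Hf) conjc_real /b; ring.
apply: le_trans (le_normcD _ _) _.
rewrite ComplexField.Normc.normcM modulus_real ger0_norm ?invr_ge0 ?sqr_ge0//.
have e1 : modulus (y x - b x z) <= A / t * h q.+1 x.
  apply: le_trans (hz x) _.
  apply: (@le_trans _ _ (A / (1 + t ^+ 2) * ((t + t^-1) * h q.+1 x))).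
    rewrite ler_wpM2l ?(ltW e0)// (le_trans (b_le x))// mulrDl lerD2r.
    by rewrite ler_wpM2l ?(ltW t0).
  rewrite mulrA ler_wpM2r//; apply: le_of_eq.
  by field; rewrite !gt_eqF.
have e2 : t ^- 2 * modulus (B q.+1 x z) <= 2 * A / t * h q.+1 x.
  apply: (@le_trans _ _ (t^-1 * h q.+1 x * (t^-1 * h q.+1 z))).
    rewrite mulrACA -expr2 exprVn ler_wpM2l ?invr_ge0 ?sqr_ge0//.
    exact: form_cauchy_schwarz.
  apply: le_trans (ler_wpM2l _ (le_trans (le_b2 z) bz)) _.
    by rewrite mulr_ge0 ?invr_ge0 ?(ltW t0).
  by apply: le_of_eq; ring.
apply: le_trans (lerD e1 e2) _.
by apply: le_of_eq; ring.
Qed.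

Fixpoint splitting_const (k : nat) : R :=
  if k is m.+1 then 3 * 2 ^+ m.+1 * splitting_const m ^+ 2 else 1.
Local Notation M := splitting_const.

Lemma splitting_const_ge1 k : 1 <= M k.
Proof.
elim: k => //= k IH; rewrite -[leLHS](mulr1 1) ler_pM ?exprn_ege1//.
by rewrite -[leLHS](mulr1 1) ler_pM ?exprn_ege1// ler1n.
Qed.

Lemma splitting_const_le k l : (k <= l)%N -> M k <= M l.
Proof.
move=> /subnK <-; elim: (l - k)%N => // m IH; rewrite addSn (le_trans IH)//=.
have := splitting_const_ge1 (m + k); move: (M _) => a a1.
rewrite -[leLHS]mul1r expr2 mulrA ler_pM//; first lra.
by rewrite -[leLHS](mulr1 1) ler_pM// -[leLHS](mulr1 1) ler_pM// ?exprn_ege1// ler1n.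
Qed.

(** Successive splittings: the error of each step is split again one step
    further in the scale, and gains a factor [s^-1]. *)
Lemma iterated_splitting (y : X -> R[i]) (q : nat) (s : R) (k : nat) : scalar y ->
  1 <= s -> (forall x, modulus (y x) <= h q x) ->
  exists Z : nat -> X,
    (forall j x, (j <= k)%N ->
      modulus (y x - f x (\sum_(0 <= i < j) Z i)) <= M j / s ^+ j * h (q + j) x) /\
    (forall i, (i < k)%N -> nrm (Z i) <= 2 ^- i * (s / s ^+ i)).
Proof.
move=> ys s1 yq; have s0 : 0 < s by lra.
elim: k => [|k [Z [Zy Zn]]].
  exists (fun=> 0); split=> // j x; rewrite leqn0 => /eqP ->.
  by rewrite big_geq// (form0r Hf) subr0 expr0 divr1 mul1r addn0.
have sk : 0 < s ^+ k by rewrite exprn_gt0.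
have Mk : 0 < M k by rewrite (lt_le_trans _ (splitting_const_ge1 k)).
have A0 : 0 < M k / s ^+ k by rewrite divr_gt0.
have t0 : 0 < s / (M k * 2 ^+ k.+1) by rewrite divr_gt0// mulr_gt0// exprn_gt0.
pose y' x := y x - f x (\sum_(0 <= i < k) Z i).
have y's : scalar y'.
  by move=> a u v; rewrite /y' ys (psd_lin Hf); ring.
have [z nz zP] := dual_splitting y's A0 t0 (fun x => Zy k x (leqnn k)).
have two_neq0 : 2 ^+ k != 0 :> R by rewrite expf_neq0.
exists (fun i => if i == k then z else Z i); split => [j x|i].
  rewrite leq_eqVlt => /predU1P[->|jk]; last first.
    rewrite (eq_big_nat _ _ (F2 := Z)) ?Zy// => i /andP[_ ij].
    by rewrite ltn_eqF// (leq_trans ij).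
  rewrite big_nat_recr//= eqxx (eq_big_nat _ _ (F2 := Z)); last first.
    by move=> i /andP[_ ik]; rewrite ltn_eqF.
  rewrite (formDr Hf) opprD addrA addnS; apply: le_trans (zP x) _.
  rewrite ler_wpM2r//; apply: le_of_eq.
  by rewrite [s ^+ k.+1]exprS [2 ^+ k.+1]exprS; field; rewrite !gt_eqF.
rewrite ltnS leq_eqVlt => /predU1P[->|ik]; last by rewrite ltn_eqF// Zn.
rewrite eqxx; apply: le_trans nz _; apply: le_of_eq.
by rewrite exprS; field; rewrite ?two_neq0 !gt_eqF.
Qed.

Definition approx_const (K : nat) : R := M K.+1 * K.+1%:R ^+ K + 2.

(** The sum of the corrections of [iterated_splitting] is one vector that serves
    every rate [K]: the corrections beyond the step [K] are small for the
    [f]-norm, the weakest of all, so that the error is measured by a norm that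
    depends on [K] only and not on the number of steps. *)
Lemma simultaneous_approximation (y : X -> R[i]) (q s : nat) : scalar y ->
  (forall x, modulus (y x) <= h q x) ->
  exists2 z, nrm z <= 2 * s.+1%:R & forall K x,
    modulus (y x - f x z) <= approx_const K / s.+1%:R ^+ K * h (q + K.+1) x.
Proof.
move=> ys yq; set w : R := s.+1%:R; have w1 : 1 <= w by rewrite ler1n.
have w0 : 0 < w by lra.
have wK K : 0 < w ^+ K by rewrite exprn_gt0.
(* [s] steps suffice at weight [s + 1]: fewer than [K] steps are made only for
   finitely many weights. *)
have [Z [Zy Zn]] := iterated_splitting s ys w1 yq.
have sum_nrm a b : (b <= s)%N ->
    nrm (\sum_(a <= i < b) Z i) <= \sum_(a <= i < b) 2 ^- i * (w / w ^+ a).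
  move=> bs; elim: b bs => [|b IH] bs.
    by rewrite !big_geq// /form_norm (form0l Hf) /= sqrtr0.
  have [ab|ba] := leqP a b; last first.
    by rewrite !big_geq// /form_norm (form0l Hf) /= sqrtr0.
  rewrite !big_nat_recr//=; apply: le_trans (form_normD Hf _ _) _.
  apply: lerD; first exact/IH/ltnW.
  apply: le_trans (Zn _ bs) _; rewrite ler_wpM2l ?invr_ge0 ?exprn_ge0//.
  by rewrite ler_wpM2l ?(ltW w0)// lef_pV2 ?posrE// ler_weXn2l.
exists (\sum_(0 <= i < s) Z i) => [|K x].
  apply: le_trans (sum_nrm 0 s (leqnn s)) _.
  rewrite -mulr_suml expr0 divr1 ler_wpM2r ?(ltW w0)//.
  exact: sum_geometric_half_le.
have MK0 : 0 <= M K.+1 by rewrite (le_trans _ (splitting_const_ge1 _)).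
have [Ks|sK] := ltnP K s; last first.
  apply: le_trans (Zy s x (leqnn s)) _.
  apply: ler_pM; rewrite ?divr_ge0 ?(ltW (wK _))//.
  - by rewrite (le_trans _ (splitting_const_ge1 _)).
  - apply: (@le_trans _ _ (M K.+1)).
      rewrite ler_pdivrMr//; apply: (@le_trans _ _ (M K.+1)).
        by apply: splitting_const_le; exact: leqW.
      by rewrite ler_peMr// exprn_ege1.
    rewrite ler_pdivlMr// /approx_const; apply: (@le_trans _ _ (M K.+1 * K.+1%:R ^+ K)).
      by rewrite ler_wpM2l// lerXn2r ?nnegrE ?(ltW w0)// ler_nat ltnS.
    by rewrite lerDl.
  - by apply: h_le; rewrite leq_add2l ltnW// ltnS.
rewrite (big_cat_nat (n := K.+1))//= (formDr Hf) opprD addrA.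
apply: le_trans (le_normcD _ _) _; rewrite normcN.
rewrite /approx_const [in leRHS]mulrDl [in leRHS]mulrDl; apply: lerD.
  apply: le_trans (Zy K.+1 x Ks) _; rewrite ler_wpM2r//; apply: ler_pM => //.
  - by rewrite invr_ge0 ltW.
  - by rewrite ler_peMr// exprn_ege1// ler1n.
  - by rewrite lef_pV2 ?posrE// ler_weXn2l.
apply: le_trans (form_cauchy_schwarz Hf _ _) _; rewrite mulrC.
apply: ler_pM => //; apply: le_trans (sum_nrm K.+1 s (leqnn s)) _.
rewrite -mulr_suml; apply: ler_pM => //.
- by apply: sumr_ge0 => i _; rewrite invr_ge0 exprn_ge0.
- by rewrite divr_ge0 ?ltW.
- exact: sum_geometric_half_le.
- by rewrite exprS invfM mulrA mulfV ?gt_eqF// mul1r.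
Qed.

(** The [d n t] are the increments of the approximations of the [n]-th coordinate
    of [h q] at the scales [(n + 1) * (t + 1)].  They sum to the coordinates, hence
    control [h q]; they decay in [t] since the errors do, and in [n] since the
    coordinates do. *)
Lemma increments q : exists d : nat -> nat -> X -> R[i],
  [/\ forall n t, scalar (d n t),
      forall n t x, modulus (d n t x) <= 4 * (n.+1%:R * t.+1%:R) * nrm x,
      forall K, exists (C : R) (r : nat), 0 < C /\ forall n t x,
        modulus (d n t x) <= C / (n.+1%:R * t.+1%:R) ^+ K * h r x
    & forall x (b : R), 0 <= b ->
        (forall n t, modulus (d n t x) <= b / (n.+1%:R * t.+1%:R) ^+ 2) ->
        h q x <= 3 * b].
Proof.
have le1 x : h q x <= 1 * h q x by rewrite mul1r.
have [y [ys yh ydecay]] := fast_coordinates HB h_mono h_link (HB q) ler01 le1.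
have yq n x : modulus (y n x) <= h q x.
  rewrite -(ler_pXn2r (ltn0Sn 1)) ?nnegrE ?modulus_ge0//.
  apply: le_trans (nneg_series_le n.+1 _ (yh x)); last by move=> k; exact: sqr_ge0.
  by rewrite big_nat_recr//= lerDr sumr_ge0// => k _; exact: sqr_ge0.
have /choice[z zP] : forall nt : nat * nat, exists z,
    nrm z <= 2 * (nt.1.+1%:R * nt.2.+1%:R) /\ forall K x,
    modulus (y nt.1 x - f x z) <=
      approx_const K / (nt.1.+1%:R * nt.2.+1%:R) ^+ K * h (q + K.+1) x.
  move=> [n t]; have [z z1 z2] := simultaneous_approximation
    (n.+1 * t.+1).-1 (ys n) (yq n).
  have e : (n.+1 * t.+1).-1.+1%:R = n.+1%:R * t.+1%:R :> R.
    by rewrite prednK ?muln_gt0// natrM.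
  by exists z; rewrite -e.
pose z' n t := if t is t'.+1 then z (n, t') else 0.
pose d n t x := f x (z (n, t) - z' n t).
have w_gt0 n t : 0 < n.+1%:R * t.+1%:R :> R by rewrite mulr_gt0.
have nz n t : nrm (z (n, t)) <= 2 * (n.+1%:R * t.+1%:R) := (zP (n, t)).1.
have nz' n t : nrm (z' n t) <= 2 * (n.+1%:R * t.+1%:R).
  case: t => [|t] /=; last by apply: le_trans (nz n t) _; rewrite !ler_pM2l// ler_nat.
  by rewrite /form_norm (form0l Hf) /= sqrtr0 mulr_ge0// ltW.
have dsum n x T : \sum_(0 <= t < T.+1) d n t x = f x (z (n, T)).
  elim: T => [|T IH]; first by rewrite big_nat1 /d /= subr0.
  by rewrite big_nat_recr//= IH /d (formBr Hf) addrC subrK.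
exists d; split.
- by move=> n t; exact: scalar_form_left.
- move=> n t x; apply: le_trans (form_cauchy_schwarz Hf _ _) _.
  rewrite mulrC ler_wpM2r//; apply: le_trans (form_normD Hf _ _) _.
  have -> : nrm (- z' n t) = nrm (z' n t).
    by rewrite -scaleN1r (form_normZ Hf) normcN ComplexField.Normc.normc1 mul1r.
  by apply: le_trans (lerD (nz n t) (nz' n t)) _; lra.
- move=> K; have [C [r [C0 CP]]] := ydecay K.
  have cK : 0 < approx_const K.
    rewrite /approx_const ltr_wpDl// mulr_ge0 ?exprn_ge0//.
    exact: le_trans (splitting_const_ge1 _).
  exists (approx_const K * (1 + 2 ^+ K) + C), (q + K.+1 + r)%N; split.
    by rewrite ltr_wpDl// mulr_ge0 ?(ltW cK)// addr_ge0// exprn_ge0.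
  move=> n t x; set w : R := n.+1%:R * t.+1%:R.
  have hr1 : h (q + K.+1) x <= h (q + K.+1 + r) x by apply: h_le; exact: leq_addr.
  have hr2 : h r x <= h (q + K.+1 + r) x by apply: h_le; exact: leq_addl.
  have wK : 0 < w ^+ K by apply/exprn_gt0/w_gt0.
  have near_z : modulus (y n x - f x (z (n, t))) <=
      approx_const K / w ^+ K * h (q + K.+1 + r) x.
    apply: le_trans ((zP (n, t)).2 K x) _.
    by rewrite ler_wpM2l// divr_ge0 ?ltW.
  have near_z' : modulus (y n x - f x (z' n t)) <=
      (approx_const K * 2 ^+ K + C) / w ^+ K * h (q + K.+1 + r) x.
    case: t @w wK near_z => [|t] w wK _ /=.
      rewrite (form0r Hf) subr0; apply: le_trans (CP n x) _.
      rewrite /w mulr1; apply: ler_pM => //.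
        by rewrite divr_ge0 ?exprn_ge0// ltW.
      rewrite ler_wpM2r ?invr_ge0 ?exprn_ge0// lerDr.
      by rewrite mulr_ge0 ?exprn_ge0// ltW.
    apply: le_trans ((zP (n, t)).2 K x) _ => /=.
    apply: ler_pM => //; first by rewrite divr_ge0 ?exprn_ge0 ?mulr_ge0// ltW.
    have w'K : 0 < ((n.+1%:R : R) * t.+1%:R) ^+ K by apply/exprn_gt0/w_gt0.
    rewrite ler_pdivrMr// mulrAC ler_pdivlMr//.
    apply: (@le_trans _ _ (approx_const K * (2 ^+ K * (n.+1%:R * t.+1%:R) ^+ K))).
      rewrite ler_wpM2l ?(ltW cK)// -exprMn lerXn2r ?nnegrE ?mulr_ge0//.
      by rewrite /w -!natrM ler_nat; lia.
    rewrite mulrA ler_wpM2r ?(ltW w'K)// lerDl ltW//.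
  have -> : d n t x = (y n x - f x (z' n t)) - (y n x - f x (z (n, t))).
    by rewrite /d (formBr Hf); ring.
  apply: le_trans (le_normcD _ _) _; rewrite normcN.
  apply: le_trans (lerD near_z' near_z) _.
  by apply: le_of_eq; ring.
- move=> x b b0 db.
  have bound n : modulus (y n x) <= 2 * b / n.+1%:R ^+ 2.
    have n2 : 0 < (n.+1%:R : R) ^+ 2 by rewrite exprn_gt0.
    have part T : modulus (y n x) <=
        approx_const 1 * h (q + 2) x * T.+1%:R^-1 + 2 * b / n.+1%:R ^+ 2.
      have -> : y n x = (y n x - f x (z (n, T))) + f x (z (n, T)) by rewrite subrK.
      apply: le_trans (le_normcD _ _) _; apply: lerD.
        apply: le_trans ((zP (n, T)).2 1 x) _ => /=.
        rewrite expr1 mulrAC ler_wpM2l//.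
          rewrite mulr_ge0// /approx_const addr_ge0// mulr_ge0 ?exprn_ge0//.
          exact: le_trans (splitting_const_ge1 _).
        by rewrite lef_pV2 ?posrE// ler_peMl// ler1n.
      rewrite -dsum; apply: le_trans (modulus_sum _ _) _.
      apply: (@le_trans _ _ (\sum_(0 <= t < T.+1) b / n.+1%:R ^+ 2 * t.+1%:R ^- 2)).
        apply: ler_sum => t _; apply: le_trans (db n t) _.
        by rewrite exprMn invfM mulrA.
      rewrite -mulr_sumr; have := @sum_inv_sq_le R T.+1.
      have c0 : 0 <= b / n.+1%:R ^+ 2 by rewrite divr_ge0 ?(ltW n2).
      by move=> /(ler_wpM2l c0)/le_trans; apply; rewrite mulrC mulrA.
    apply: (@cvgr_to_ge _ \oo _ _
      (fun T => approx_const 1 * h (q + 2) x * T.+1%:R^-1 + 2 * b / n.+1%:R ^+ 2)).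
      rewrite -[X in _ --> X]add0r; apply: cvgD; last exact: cvg_cst.
      rewrite -[X in _ --> X](mulr0 (approx_const 1 * h (q + 2) x)).
      by apply: cvgMr; exact: cvg_harmonic.
    by near=> T; exact: part.
  rewrite -(ler_pXn2r (ltn0Sn 1)) ?nnegrE ?mulr_ge0//.
  apply: (cvgn_le_bound (yh x)) => N.
  apply: (@le_trans _ _ (\sum_(0 <= n < N) 4 * b ^+ 2 * n.+1%:R ^- 2)).
    apply: ler_sum => n _.
    apply: (@le_trans _ _ ((2 * b / n.+1%:R ^+ 2) ^+ 2)).
      by rewrite lerXn2r ?nnegrE ?modulus_ge0// (le_trans _ (bound n))// modulus_ge0.
    rewrite expr_div_n exprMn (_ : 2 ^+ 2 = 4 :> R); last by rewrite -natrX.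
    rewrite ler_wpM2l ?mulr_ge0 ?sqr_ge0//.
    by rewrite lef_pV2 ?posrE ?exprn_gt0// -!exprM ler_weXn2l// ler1n.
  rewrite -mulr_sumr; apply: le_trans (ler_wpM2l _ (@sum_inv_sq_le R N)) _.
    by rewrite mulr_ge0 ?sqr_ge0.
  by have := sqr_ge0 b; rewrite exprMn; lra.
Unshelve. all: by end_near. Qed.

(** All increments, of all the norms [h q], in one sequence.  The weight
    [w ^- (q + 5)] makes the functionals of large [q] decay by their [f]-norm
    alone, so that for each rate only finitely many [q] matter; being a fixed
    power of [w] for each [q], it does not spoil the control of [h q]. *)
Lemma controlling_functionals : exists v : nat -> X -> R[i],
  [/\ forall j, scalar (v j),
      forall x n, \sum_(0 <= j < n) modulus (v j x) ^+ 2 <= nrm x ^+ 2,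
      forall K, exists (C : R) (r : nat), 0 < C /\ forall j x,
        modulus (v j x) <= C / j.+1%:R ^+ K * h r x
    & forall q, exists (k : nat) (C : R), 0 < C /\ forall x (b : R), 0 <= b ->
        (forall j, modulus (v j x) <= b / j.+1%:R ^+ k) -> h q x <= C * b].
Proof.
have /choice[d dP] := increments.
pose Q j := (unpair j).1; pose a j := (unpair (unpair j).2).1.
pose t j := (unpair (unpair j).2).2.
pose w j : R := (a j).+1%:R * (t j).+1%:R.
(* The factor 8 and the exponent [Q j + 2] keep the sum of squares below the
   square of the norm. *)
pose c j : R := (8 * (Q j).+1%:R ^+ (Q j + 2) * w j ^+ (Q j + 5))^-1.
pose v j x := (c j)%:C%C * d (Q j) (a j) (t j) x.
have w1 j : 1 <= w j by rewrite -[leLHS]mulr1 ler_pM ?ler1n.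
have w0 j : 0 < w j by rewrite (lt_le_trans ltr01).
have q1 j : 1 <= (Q j).+1%:R :> R by rewrite ler1n.
have jb j : j.+1%:R <= (Q j).+1%:R ^+ 2 * w j ^+ 4 :> R.
  by rewrite /w -natrM -!natrX -natrM ler_nat; exact: index_bound.
have c0 j : 0 < c j.
  by rewrite invr_gt0 !mulr_gt0// exprn_gt0.
have c1 j : c j <= 1.
  rewrite invf_le1; last by rewrite -invr_gt0; exact: c0.
  rewrite -[leLHS]mulr1 ler_pM ?exprn_ege1// -[leLHS]mulr1 ler_pM ?exprn_ege1//.
  by rewrite ler1n.
have vE j x : modulus (v j x) = c j * modulus (d (Q j) (a j) (t j) x).
  by rewrite /v ComplexField.Normc.normcM modulus_real gtr0_norm.
have v_nrm j x : modulus (v j x) <= 4 * c j * w j * nrm x.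
  have [_ d4 _ _] := dP (Q j); rewrite vE.
  apply: le_trans (ler_wpM2l (ltW (c0 j)) (d4 (a j) (t j) x)) _.
  by rewrite -/(w j); apply: le_of_eq; ring.
(* With the weights in place, [v j] is small by its [f]-norm alone at every
   rate [K] with [4 * K <= Q j]. *)
have cw j K : (2 * K <= Q j + 2)%N -> (4 * K <= Q j + 4)%N ->
    4 * c j * w j <= 2^-1 / j.+1%:R ^+ K.
  move=> K1 K2; have jK : 0 < (j.+1%:R : R) ^+ K by rewrite exprn_gt0.
  rewrite ler_pdivlMr// /c.
  set D := 8 * _ * _; have D0 : 0 < D by rewrite -invr_gt0; exact: c0.
  rewrite -(ler_pM2r D0) [leLHS](_ : _ = 4 * (w j * j.+1%:R ^+ K)); last first.
    by field; rewrite gt_eqF.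
  rewrite [leRHS](_ : _ = 4 * ((Q j).+1%:R ^+ (Q j + 2) * w j ^+ (Q j + 5))); last first.
    by rewrite /D; field.
  rewrite ler_wpM2l//.
  have jK' : j.+1%:R ^+ K <= (Q j).+1%:R ^+ (2 * K) * w j ^+ (4 * K).
    rewrite !exprM -exprMn lerXn2r ?nnegrE//.
    by rewrite mulr_ge0 ?exprn_ge0// ltW.
  apply: le_trans (ler_wpM2l (ltW (w0 j)) jK') _.
  rewrite mulrCA -exprS; apply: ler_pM; rewrite ?exprn_ge0 ?(ltW (w0 j))//.
    by rewrite ler_weXn2l.
  by rewrite ler_weXn2l// addnS ltnS.
exists v; split.
- move=> j x x' x''; have [ds _ _ _] := dP (Q j).
  by rewrite /v ds; ring.
- move=> x n.
  apply: (@le_trans _ _ (\sum_(0 <= j < n) (4^-1 * nrm x ^+ 2) * j.+1%:R ^- 2)).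
    apply: ler_sum => j _.
    have le1 : modulus (v j x) <= 2^-1 / j.+1%:R * nrm x.
      apply: le_trans (v_nrm j x) _; rewrite ler_wpM2r//.
      by have := cw j 1; rewrite expr1; apply; lia.
    apply: (@le_trans _ _ ((2^-1 / j.+1%:R * nrm x) ^+ 2)).
      by rewrite lerXn2r ?nnegrE ?modulus_ge0// (le_trans _ le1)// modulus_ge0.
    by apply: le_of_eq; field.
  rewrite -mulr_sumr; apply: le_trans (ler_wpM2l _ (@sum_inv_sq_le R n)) _.
    by rewrite mulr_ge0 ?sqr_ge0.
  by have := sqr_ge0 (nrm x); lra.
- move=> K.
  have /choice[Cr CrP] : forall q, exists Cr : R * nat, 0 < Cr.1 /\ forall n t x,
      modulus (d q n t x) <= Cr.1 / (n.+1%:R * t.+1%:R) ^+ (4 * K) * h Cr.2 x.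
    by move=> q; have [_ _ /(_ (4 * K)%N)[C [r ?]] _] := dP q; exists (C, r).
  pose C := 1 + \sum_(0 <= q < 4 * K) (Cr q).1 * (4 * K)%:R ^+ (2 * K).
  pose r := (\sum_(0 <= q < 4 * K) (Cr q).2)%N.
  have Cq0 q : 0 <= (Cr q).1 * (4 * K)%:R ^+ (2 * K).
    by rewrite mulr_ge0 ?exprn_ge0// ltW//; have [] := CrP q.
  exists C, r; split; first by rewrite ltr_wpDr// sumr_ge0.
  move=> j x; have jK : 0 < (j.+1%:R : R) ^+ K by rewrite exprn_gt0.
  have [large|small] := leqP (4 * K) (Q j).
    apply: le_trans (v_nrm j x) _; apply: ler_pM => //.
      by rewrite !mulr_ge0// ltW.
    apply: (@le_trans _ _ (2^-1 / j.+1%:R ^+ K)); first by apply: cw; lia.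
    rewrite ler_wpM2r ?invr_ge0 ?(ltW jK)//.
    have : 0 <= \sum_(0 <= q < 4 * K) (Cr q).1 * (4 * K)%:R ^+ (2 * K) by rewrite sumr_ge0.
    by rewrite /C; lra.
  have [C0 CP] := CrP (Q j).
  have hr : h (Cr (Q j)).2 x <= h r x.
    apply: h_le; rewrite /r (big_cat_nat (n := Q j))//= ?(ltnW small)//.
    by rewrite [X in (_ <= _ + X)%N]big_ltn// addnCA leq_addr.
  have hC : (Cr (Q j)).1 * (4 * K)%:R ^+ (2 * K) <= C.
    rewrite /C (big_cat_nat (n := Q j))//= ?(ltnW small)//.
    rewrite [X in _ <= _ + (_ + X)]big_ltn//.
    set s1 := \sum_(_ <= _ < _) _; set s2 := \sum_(_ <= _ < _) _.
    have : 0 <= s1 by rewrite sumr_ge0.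
    have : 0 <= s2 by rewrite sumr_ge0.
    lra.
  apply: (@le_trans _ _ (modulus (d (Q j) (a j) (t j) x))).
    by rewrite vE -[leRHS]mul1r ler_wpM2r// modulus_ge0.
  apply: le_trans (CP (a j) (t j) x) _; rewrite -/(w j); apply: ler_pM => //.
    by rewrite divr_ge0 ?exprn_ge0// ltW.
  have wK : 0 < w j ^+ (4 * K) by rewrite exprn_gt0.
  rewrite ler_pdivrMr// mulrAC ler_pdivlMr//.
  apply: (@le_trans _ _ ((Cr (Q j)).1 * ((4 * K)%:R ^+ (2 * K) * w j ^+ (4 * K)))).
    rewrite ler_wpM2l ?(ltW C0)// !exprM -exprMn lerXn2r ?nnegrE//.
      by rewrite mulr_ge0 ?exprn_ge0// ltW.
    apply: le_trans (jb j) _; rewrite ler_wpM2r ?exprn_ge0 ?(ltW (w0 j))//.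
    by rewrite lerXn2r ?nnegrE// ler_nat.
  by rewrite mulrA ler_wpM2r// ltW.
- move=> q; exists (2 * (q + 7))%N, (3 * (8 * q.+1%:R ^+ (q + 2))); split.
    by rewrite !mulr_gt0// exprn_gt0.
  move=> x b b0 hv; have [_ _ _ lower] := dP q.
  rewrite -[3 * _ * b]mulrA; apply: lower => [|n t'].
    by rewrite !mulr_ge0// exprn_ge0.
  pose j := pairn q (pairn n t').
  have Qj : Q j = q by rewrite /Q /j pairnK.
  have aj : a j = n by rewrite /a /j !pairnK.
  have tj : t j = t' by rewrite /t /j !pairnK.
  have := hv j; rewrite vE Qj aj tj mulrC -ler_pdivlMr// => /le_trans; apply.
  have wj : w j = n.+1%:R * t'.+1%:R by rewrite /w aj tj.
  rewrite -wj /c Qj invrK.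
  have wq : 0 < w j ^+ (q + 7) by rewrite exprn_gt0.
  have jj : w j ^+ (q + 7) <= j.+1%:R ^+ (2 * (q + 7)).
    rewrite exprM lerXn2r ?nnegrE ?(ltW (w0 j)) ?sqr_ge0//.
    by rewrite wj -natrM -natrX ler_nat; exact: pairn_ge.
  apply: (@le_trans _ _ (b / w j ^+ (q + 7) * (8 * q.+1%:R ^+ (q + 2) * w j ^+ (q + 5)))).
    rewrite ler_wpM2r//; first by rewrite !mulr_ge0 ?exprn_ge0 ?(ltW (w0 j)).
    by rewrite ler_wpM2l// lef_pV2 ?posrE// (lt_le_trans wq).
  apply: le_of_eq.
  rewrite -[(q + 7)%N]/(q + (5 + 2))%N addnA exprD; field.
  by rewrite !expf_neq0 ?gt_eqF.
Qed.

(** The sequences [controlling_functionals] control all the norms; coordinates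
    for what is left of the square of the norm make the embedding isometric. *)
Lemma isometric_functionals : exists v : nat -> X -> R[i],
  [/\ forall j, scalar (v j),
      forall x, series (fun j => modulus (v j x) ^+ 2) @ \oo --> nrm x ^+ 2,
      forall K, exists (C : R) (r : nat), 0 < C /\ forall j x,
        modulus (v j x) <= C / j.+1%:R ^+ K * h r x
    & forall q, exists (k : nat) (C : R), 0 < C /\ forall x (b : R), 0 <= b ->
        (forall j, modulus (v j x) <= b / j.+1%:R ^+ k) -> h q x <= C * b].
Proof.
have [v [vs vn vdecay vlower]] := controlling_functionals.
have vcvg x : cvgn (series (fun j => modulus (v j x) ^+ 2)).
  by apply: (@nneg_series_cvg _ _ (nrm x ^+ 2)) => // j; exact: sqr_ge0.
have [B0 HB0 B0v] := limit_form vs vcvg.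
have B0le x : form_norm B0 x <= nrm x.
  rewrite -(ler_pXn2r (ltn0Sn 1)) ?nnegrE ?form_norm_ge0// B0v.
  exact: (cvgn_le_bound (vcvg x) (vn x)).
have HB1 := psd_form_sub Hf HB0 B0le.
set B1 := (fun x y => f x y - B0 x y) in HB1.
have B1v x : form_norm B1 x ^+ 2 = nrm x ^+ 2 - form_norm B0 x ^+ 2.
  by rewrite !sqr_form_norm// /B1 ReB.
have B1le x : form_norm B1 x <= 1 * h 0 x.
  rewrite mul1r; apply: le_trans (nrm_le x).
  by rewrite -(ler_pXn2r (ltn0Sn 1)) ?nnegrE ?form_norm_ge0// B1v gerBl sqr_ge0.
have [u [us un udecay]] := fast_coordinates HB h_mono h_link HB1 ler01 B1le.
pose V j x := if odd j then u j./2 x else v j./2 x.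
exists V; split.
- by move=> j; rewrite /V; case: (odd j).
- move=> x.
  have V0 j : 0 <= modulus (V j x) ^+ 2 by exact: sqr_ge0.
  have VE n : \sum_(0 <= j < n.*2) modulus (V j x) ^+ 2 =
      \sum_(0 <= j < n) modulus (v j x) ^+ 2 + \sum_(0 <= j < n) modulus (u j x) ^+ 2.
    rewrite -(interleaved_sum (fun j => modulus (u j x) ^+ 2)).
    by apply: eq_bigr => j _; rewrite /V; case: ifP.
  have two : (fun n => \sum_(0 <= j < n.*2) modulus (V j x) ^+ 2) @ \oo --> nrm x ^+ 2.
    rewrite (_ : (fun n => _) = fun n => series (fun j => modulus (v j x) ^+ 2) n +
        series (fun j => modulus (u j x) ^+ 2) n); last exact/funext.
    rewrite (_ : nrm x ^+ 2 = form_norm B0 x ^+ 2 + form_norm B1 x ^+ 2); last first.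
      by rewrite B1v addrC subrK.
    by apply: cvgD => //; rewrite B0v; exact: vcvg.
  have bound n : \sum_(0 <= j < n) modulus (V j x) ^+ 2 <= nrm x ^+ 2.
    apply: (@le_trans _ _ (\sum_(0 <= j < n.*2) modulus (V j x) ^+ 2)).
      rewrite [leRHS](@big_cat_nat _ _ _ n)//= -?addnn ?leq_addr//.
      by rewrite lerDl sumr_ge0.
    rewrite -(cvg_lim _ two)//.
    apply: (@nondecreasing_cvgn_le _ (fun n => \sum_(0 <= j < n.*2) modulus (V j x) ^+ 2)).
      by apply/nondecreasing_seqP => m; rewrite !VE !big_nat_recr//= lerD ?lerDl ?sqr_ge0.
    by apply/cvg_ex; exists (nrm x ^+ 2).
  have := nneg_series_cvg V0 bound => /cvg_ex[l ll].
  suff -> : nrm x ^+ 2 = l by [].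
  apply: (cvg_unique _ two) => //.
  apply: (@cvg_comp _ _ _ double (series (fun j => modulus (V j x) ^+ 2)) _ _ _ _ ll).
  apply/cvgnyPge => A; near=> n.
  by apply: (@leq_trans n); [near: n; exact: nbhs_infty_ge|rewrite -addnn leq_addr].
- move=> K; have [C [r [C0 CP]]] := vdecay K; have [D [s [D0 DP]]] := udecay K.
  exists (2 ^+ K * (C + D)), (r + s)%N; split; first by rewrite mulr_gt0 ?exprn_gt0 ?addr_gt0.
  move=> j x; have jK : 0 < (j.+1%:R : R) ^+ K by rewrite exprn_gt0.
  have jK' : 0 < ((j./2).+1%:R : R) ^+ K by rewrite exprn_gt0.
  have half (E : R) : 0 < E -> E <= C + D ->
      E / (j./2).+1%:R ^+ K <= 2 ^+ K * (C + D) / j.+1%:R ^+ K.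
    move=> E0 ECD; rewrite ler_pdivrMr// mulrAC ler_pdivlMr//.
    rewrite [leRHS](_ : _ = (C + D) * (2 * (j./2).+1%:R) ^+ K); last by rewrite exprMn; ring.
    apply: ler_pM; rewrite ?(ltW E0) ?(ltW jK)//.
    rewrite lerXn2r ?nnegrE ?mulr_ge0// -natrM ler_nat.
    by rewrite -{1}(odd_double_half j); case: (odd j); lia.
  rewrite /V; case: (odd j).
    apply: le_trans (DP _ x) _; apply: ler_pM => //; first by rewrite divr_ge0 ?ltW.
      by apply: half => //; rewrite lerDr ltW.
    by apply: h_le; exact: leq_addl.
  apply: le_trans (CP _ x) _; apply: ler_pM => //; first by rewrite divr_ge0 ?ltW.
    by apply: half => //; rewrite lerDl ltW.
  by apply: h_le; exact: leq_addr.
- move=> q; have [k [C [C0 CP]]] := vlower q; exists k, C; split => // x b b0 hV.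
  apply: CP => // j; have := hV j.*2; rewrite /V odd_double doubleK => /le_trans; apply.
  rewrite ler_wpM2l// lef_pV2 ?posrE ?exprn_gt0// lerXn2r ?nnegrE//.
  by rewrite ler_nat ltnS -addnn leq_addr.
Unshelve. all: by end_near. Qed.

End DominatingScale.

(** * Continuous seminorms *)

Section SeminormAlgebra.
Context {R : realType} {X : lmodType R[i]}.
Variable p : X -> R.
Hypothesis ps : is_seminorm p.

Lemma seminorm_ge0 x : 0 <= p x. Proof. by case: ps. Qed.

Lemma seminormD x y : p (x + y) <= p x + p y. Proof. by case: ps. Qed.

Lemma seminormZ a x : p (a *: x) = modulus a * p x. Proof. by case: ps. Qed.

Lemma seminormN x : p (- x) = p x.
Proof. by rewrite -scaleN1r seminormZ normcN ComplexField.Normc.normc1 mul1r. Qed.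

Lemma seminorm0 : p 0 = 0.
Proof. by rewrite -(scale0r 0) seminormZ ComplexField.Normc.normc0 mul0r. Qed.

Lemma seminormB x y : p (x - y) <= p x + p y.
Proof. by rewrite -(seminormN y); exact: seminormD. Qed.

Lemma seminorm_sub_le x y : `|p x - p y| <= p (x - y).
Proof.
rewrite ler_norml; apply/andP; split.
  have := seminormD (y - x) x; rewrite subrK -(seminormN (y - x)) opprB; lra.
by have := seminormD (x - y) y; rewrite subrK; lra.
Qed.

Lemma seminorm_sum (I : Type) (r : seq I) (F : I -> X) :
  p (\sum_(i <- r) F i) <= \sum_(i <- r) p (F i).
Proof.
elim: r => [|i r IH]; first by rewrite !big_nil seminorm0.
by rewrite !big_cons (le_trans (seminormD _ _))// lerD2l.
Qed.

End SeminormAlgebra.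

Section SeminormTopology.
Context {R : realType} (X : tvsType R[i]).
Implicit Types (p q : X -> R) (x y : X).

Definition cont_seminorm p := is_seminorm p /\ continuous p.

Lemma seminorm_scale (c : R) p : 0 <= c -> is_seminorm p ->
  is_seminorm (fun x => c * p x).
Proof.
move=> c0 [p0 pD pZ]; split => [x|x y|a x]; first exact: mulr_ge0.
- by rewrite -mulrDr ler_wpM2l.
- by rewrite pZ mulrCA.
Qed.

Lemma seminorm_add p q : is_seminorm p -> is_seminorm q ->
  is_seminorm (fun x => p x + q x).
Proof.
move=> [p0 pD pZ] [q0 qD qZ]; split => [x|x y|a x]; first exact: addr_ge0.
- by rewrite addrACA lerD.
- by rewrite pZ qZ mulrDr.
Qed.

Lemma sub_continuous x : continuous (fun y => y - x).
Proof.
move=> y; apply: (@continuous2_cvg X X X X (nbhs y) _ id (cst (- x)) (fun u v => u + v)).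
- exact: (@add_continuous X (y, - x)).
- exact: cvg_id.
- exact: cvg_cst.
Qed.

Lemma add_cst_continuous x : continuous (fun y => y + x).
Proof. by move=> y; rewrite -[x]opprK; exact: sub_continuous. Qed.

Lemma seminorm_nbhs p : cont_seminorm p -> forall x (e : R), 0 < e ->
  nbhs x [set y | p (y - x) < e].
Proof.
move=> [ps pc] x e e0.
have : (fun y => p (y - x)) @ x --> p (x - x).
  by apply: continuous_comp; [exact: sub_continuous|exact: pc].
rewrite subrr seminorm0// => /cvgr_lt; exact.
Qed.

Lemma continuous_seminorm_nbhs p : is_seminorm p ->
  (forall (x : X) (e : R), 0 < e -> nbhs x [set y | p (y - x) < e]) -> continuous p.
Proof.
move=> ps pn x; apply/cvgrPdist_lt => e e0; apply: filterS (pn x e e0) => y /= yx.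
by apply: le_lt_trans yx; rewrite distrC; exact: seminorm_sub_le.
Qed.

Lemma dominated_cont_seminorm (c : R) p q : is_seminorm p -> cont_seminorm q ->
  (forall x, p x <= c * q x) -> cont_seminorm p.
Proof.
move=> ps qc pq; split => //; apply: continuous_seminorm_nbhs => // x e e0.
have c1 : 0 < `|c| + 1 by rewrite ltr_wpDl.
apply: filterS (seminorm_nbhs qc x (divr_gt0 e0 c1)) => y /=.
rewrite ltr_pdivlMr// mulrC => h; apply: le_lt_trans (pq _) (le_lt_trans _ h).
apply: ler_wpM2r; first by apply: seminorm_ge0; case: qc.
by rewrite (le_trans (ler_norm c))// lerDl.
Qed.

Lemma cont_seminorm_add p q : cont_seminorm p -> cont_seminorm q ->
  cont_seminorm (fun x => p x + q x).
Proof.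
move=> [ps pc] [qs qc]; split; first exact: seminorm_add.
by move=> x; apply: cvgD; [exact: pc|exact: qc].
Qed.

Lemma cont_seminorm_scale (c : R) p : 0 <= c -> cont_seminorm p ->
  cont_seminorm (fun x => c * p x).
Proof.
move=> c0 [ps pc]; split; first exact: seminorm_scale.
by move=> x; apply: cvgMr; exact: pc.
Qed.

Lemma seminorm_ball_le p q (e : R) : is_seminorm p -> is_seminorm q -> 0 < e ->
  (forall x, q x < e -> p x <= 1) -> forall x, p x <= 2 / e * q x.
Proof.
move=> ps qs e0 ball x.
have p0 := seminorm_ge0 ps x; have q0 := seminorm_ge0 qs x.
have scaled (t : R) : 0 < t -> t * q x < e -> t * p x <= 1.
  move=> t0 tq; have := ball (t%:C%C *: x).
  by rewrite (seminormZ ps) (seminormZ qs) modulus_real gtr0_norm//; apply.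
have [q00|qn0] := eqVneq (q x) 0.
  rewrite q00 mulr0 leNgt; apply/negP => pp.
  have := scaled (2 / p x); rewrite divr_gt0// q00 mulr0 divfK ?gt_eqF//.
  by move=> /(_ isT e0); lra.
have qp : 0 < q x by rewrite lt_neqAle eq_sym qn0.
have := scaled (e / 2 / q x); rewrite !divr_gt0// divfK ?gt_eqF//.
move=> /(_ isT); have e2 : e / 2 < e by lra.
move=> /(_ e2); rewrite mulrAC ler_pdivrMr// mul1r => le1.
rewrite -(ler_pM2l e0) mulrA mulrCA divff ?gt_eqF// mulr1; lra.
Qed.

Lemma fundamental_cont P : increasing_fundamental_system P ->
  forall k, cont_seminorm (P k).
Proof.
move=> [Ps Pm PN] k; split => //; apply: continuous_seminorm_nbhs => // x e e0.
have : nbhs (0 : X) [set y | P k y < e] by apply/PN; exists k, e.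
have : (fun y => y - x) @ x --> (x - x : X) by exact: sub_continuous.
by rewrite subrr; apply.
Qed.

Lemma fundamental_dominates P p : increasing_fundamental_system P ->
  cont_seminorm p -> exists k, exists2 C : R, 0 < C & forall x, p x <= C * P k x.
Proof.
move=> [Ps Pm PN] pc; have := seminorm_nbhs pc 0 ltr01 => /PN[k [e e0 ke]].
exists k, (2 / e) => [|x]; first exact: divr_gt0.
apply: seminorm_ball_le => //; first by case: pc.
by move=> y /ke /=; rewrite subr0 => /ltW.
Qed.

End SeminormTopology.

(** * Hilbert scales in a nuclear space *)

Section Nuclear.
Context {R : realType} (X : tvsType R[i]).

(** As [hs_link], relative to a seminorm that need not come from a form: the next
    form of the scale will dominate it. *)
Definition hs_form (B : X -> X -> R[i]) (Q : X -> R) :=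
  exists (w : nat -> X -> R[i]) (g : nat -> R) (S : R),
  [/\ forall n, scalar (w n),
      forall n, 0 <= g n /\ forall x, modulus (w n x) <= g n * Q x,
      forall x, series (fun n => modulus (w n x) ^+ 2) @ \oo --> form_norm B x ^+ 2
    & forall n, \sum_(0 <= k < n) g k ^+ 2 <= S].

Lemma completion_cvg (p : X -> R) (z : nat -> X) : is_seminorm p ->
  seminorm_cauchy p z -> p \o z @ \oo --> completion_norm p z.
Proof.
move=> ps pz; apply/cvg_ex.
suff : cvgn (p \o z) by move=> /cvg_ex[l pl]; exists l.
apply: R_complete; apply: cauchy_exP => e e0.
have [N NP] := pz e e0.
exists (p (z N)); exists N => // m /= Nm.
rewrite /ball /=; apply: le_lt_trans (seminorm_sub_le ps _ _) (NP _ _ _ _) => //.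
Qed.

Lemma seminorm_cauchy_sub_sum (p : X -> R) (x : X) (a : nat -> R[i])
  (N : nat) (z : nat -> nat -> X) : is_seminorm p ->
  (forall n, seminorm_cauchy p (z n)) ->
  seminorm_cauchy p (fun m => x - \sum_(0 <= n < N) a n *: z n m).
Proof.
move=> ps zc.
elim: N => [|N IH] e e0.
  by exists 0 => m k _ _; rewrite !big_geq// subrr seminorm0.
have e2 : 0 < e / 2 by rewrite divr_gt0.
have y1 : 0 < modulus (a N) + 1 by rewrite ltr_wpDl ?modulus_ge0.
have [M1 M1P] := IH _ e2; have [M2 M2P] := zc N _ (divr_gt0 e2 y1).
exists (maxn M1 M2) => m k; rewrite !geq_max => /andP[m1 m2] /andP[k1 k2].
rewrite !big_nat_recr//= !(opprD (\sum_(_ <= _ < _) _)) !addrA.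
set u := x - \sum_(0 <= n < N) a n *: z n m.
set v := x - \sum_(0 <= n < N) a n *: z n k.
have -> : u - a N *: z N m - (v - a N *: z N k) =
    (u - v) - a N *: (z N m - z N k).
  by rewrite scalerBr !opprD addrACA.
apply: le_lt_trans (seminormB ps _ _) _; rewrite (seminormZ ps).
have l1 := M1P _ _ m1 k1; have := M2P _ _ m2 k2.
rewrite ltr_pdivlMr// => l2.
have l3 : modulus (a N) * p (z N m - z N k) <= p (z N m - z N k) * (modulus (a N) + 1).
  by rewrite mulrC ler_wpM2l ?seminorm_ge0// lerDl.
rewrite -/u -/v in l1; lra.
Qed.

(** For a nuclear link [\sum_n y_n(x) z_n] with [|y_n| <= c_n * Q] and
    [a_n := ||z_n||], the Cauchy-Schwarz inequality with weights [c_n * a_n] yields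
    [p x ^+ 2 <= (\sum_n c_n a_n) * \sum_n (a_n / c_n) * |y_n x| ^+ 2], and the
    right-hand side is the square of a Hilbert seminorm. *)
Lemma nuclear_hs_form (p : X -> R) : nuclear X -> cont_seminorm p ->
  exists (B : X -> X -> R[i]) (Q : X -> R),
  [/\ psd_form B, cont_seminorm Q, hs_form B Q & forall x, p x <= form_norm B x].
Proof.
move=> nX [ps pc].
have [Q [Qs Qc pQ [y [c [z [yc zc acvg ylink]]]]]] := nX p ps pc.
pose a n := completion_norm p (z n).
have pz n : p \o z n @ \oo --> a n by apply: completion_cvg.
have Q0 x : 0 <= Q x by exact: seminorm_ge0.
have c0 n : 0 <= c n by case: (yc n).
have a0 n : 0 <= a n.
  rewrite -(cvg_lim _ (pz n))//; apply: limr_ge; first by apply/cvg_ex; exists (a n).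
  by near=> m; exact: seminorm_ge0.
have ca0 n : 0 <= c n * a n by rewrite mulr_ge0.
have [T TS] := (cvg_ex _).1 acvg.
have sumT N : \sum_(0 <= n < N) c n * a n <= T by exact: nneg_series_le ca0 TS.
have T0 : 0 <= T by have := sumT 0; rewrite big_geq.
have Tc n : 0 <= T * (a n / c n) by rewrite mulr_ge0// divr_ge0.
pose w n x := (Num.sqrt (T * (a n / c n)))%:C%C * y n x.
pose g n := Num.sqrt (T * (a n / c n)) * c n.
have ws n : scalar (w n) by move=> b x x'; rewrite /w linearP /=; ring.
have wE n x : modulus (w n x) = Num.sqrt (T * (a n / c n)) * modulus (y n x).
  by rewrite /w ComplexField.Normc.normcM modulus_real ger0_norm// sqrtr_ge0.
have g0 n : 0 <= g n by rewrite mulr_ge0// sqrtr_ge0.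
have wg n x : modulus (w n x) <= g n * Q x.
  by rewrite wE -mulrA ler_wpM2l ?sqrtr_ge0//; case: (yc n) => _; exact.
have gS N : \sum_(0 <= n < N) g n ^+ 2 <= T * T.
  apply: (@le_trans _ _ (T * \sum_(0 <= n < N) c n * a n)); last by rewrite ler_wpM2l.
  rewrite mulr_sumr; apply: ler_sum => n _; rewrite exprMn sqr_sqrtr//.
  have [->|cn0] := eqVneq (c n) 0; first by rewrite expr0n mulr0 mul0r mulr0.
  by apply: le_of_eq; field.
have wcvg x : cvgn (series (fun n => modulus (w n x) ^+ 2)).
  apply: (@nneg_series_cvg _ _ (T * T * Q x ^+ 2)) => [n|N]; first exact: sqr_ge0.
  apply: (@le_trans _ _ ((\sum_(0 <= n < N) g n ^+ 2) * Q x ^+ 2)).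
    rewrite mulr_suml; apply: ler_sum => n _; rewrite -exprMn.
    by rewrite lerXn2r ?nnegrE ?modulus_ge0// mulr_ge0.
  by rewrite ler_wpM2r ?sqr_ge0.
have [B HB BE] := limit_form ws wcvg.
exists B, Q; split => //.
  by exists w, g, (T * T); split => // x; rewrite BE; exact: wcvg.
move=> x.
have cauchy_schwarz N : \sum_(0 <= n < N) modulus (y n x) * a n <= form_norm B x.
  set A := \sum_(_ <= _ < _) _.
  have A0 : 0 <= A by apply: sumr_ge0 => n _; rewrite mulr_ge0 ?modulus_ge0.
  rewrite -(ler_pXn2r (ltn0Sn 1)) ?nnegrE ?form_norm_ge0//.
  apply: (@le_trans _ _ (T * \sum_(0 <= n < N) a n / c n * modulus (y n x) ^+ 2)).
    apply: sqr_le_of_quadratic => //.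
      by apply: sumr_ge0 => n _; rewrite mulr_ge0 ?sqr_ge0// divr_ge0.
    move=> s s0; apply: le_trans (lerD (sumT N) (lexx _)).
    rewrite !mulr_sumr -big_split /=; apply: ler_sum => n _.
    have [cn0|cn0] := eqVneq (c n) 0.
      have -> : modulus (y n x) = 0.
        apply/eqP; rewrite eq_le modulus_ge0 andbT.
        by have [_ /(_ x)] := yc n; rewrite cn0 mul0r.
      by rewrite mul0r mulr0 expr0n !mulr0 addr0 mulr_ge0.
    rewrite -subr_ge0 [leRHS](_ : _ = a n / c n * (c n - s * modulus (y n x)) ^+ 2).
      by rewrite mulr_ge0 ?sqr_ge0// divr_ge0.
    by field.
  rewrite BE mulr_sumr; apply: le_trans (nneg_series_le N _ (wcvg x)).
    apply: ler_sum => n _; rewrite wE exprMn sqr_sqrtr// mulrA.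
    exact: lexx.
  by move=> n; exact: sqr_ge0.
have part N : p x <= completion_norm p (fun m => x - \sum_(0 <= n < N) y n x *: z n m)
    + form_norm B x.
  have cauchyN : seminorm_cauchy p (fun m => x - \sum_(0 <= n < N) y n x *: z n m).
    exact: (seminorm_cauchy_sub_sum x (fun n => y n x) N ps zc).
  apply: le_trans (lerD (lexx _) (cauchy_schwarz N)).
  have lim1 := completion_cvg ps cauchyN.
  have lim2 : (fun m => \sum_(0 <= n < N) modulus (y n x) * p (z n m)) @ \oo -->
      \sum_(0 <= n < N) modulus (y n x) * a n.
    rewrite big_mkord; under eq_fun do rewrite big_mkord.
    apply: (@sum_cvgn _ (fun n m => modulus (y n x) * p (z n m))
      (fun n => modulus (y n x) * a n)) => n.
    by apply: cvgMr; exact: pz.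
  apply: (@cvgr_to_ge _ \oo _ _ _ _ _ (cvgD lim1 lim2)).
  near=> m => /=.
  rewrite -{1}(subrK (\sum_(0 <= n < N) y n x *: z n m) x).
  apply: le_trans (seminormD ps _ _) _; rewrite lerD2l.
  apply: le_trans (seminorm_sum ps _ _) _; apply: ler_sum => n _.
  by rewrite (seminormZ ps).
have lim3 : (fun N => completion_norm p (fun m => x - \sum_(0 <= n < N) y n x *: z n m)
    + form_norm B x) @ \oo --> 0 + form_norm B x.
  by apply: cvgD; [exact: ylink|exact: cvg_cst].
rewrite -[leRHS]add0r.
by apply: (@cvgr_to_ge _ \oo _ _ _ _ _ lim3); near=> N; exact: part.
Unshelve. all: by end_near. Qed.

End Nuclear.

Section HilbertScaleConstruction.
Context {R : realType} (X : tvsType R[i]).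
Variables (f : X -> X -> R[i]) (P : nat -> X -> R).
Hypothesis Hf : psd_form f.
Hypothesis nX : nuclear X.
Hypothesis HP : increasing_fundamental_system P.
Hypothesis f_cont : continuous (form_norm f).
Hypothesis P_dominating : forall q, exists r, exists2 C : R, 0 < C &
  forall x, P q x ^+ 2 <= C * form_norm f x * P r x.
Local Notation nrm := (form_norm f).

Let nrmc : cont_seminorm nrm.
Proof. by split => //; exact: form_norm_seminorm. Qed.

Let PC := fundamental_cont HP.

Definition scale_level (D : (X -> X -> R[i]) * (X -> R)) :=
  [/\ psd_form D.1, cont_seminorm D.2 & hs_form D.1 D.2].

Lemma hs_form_cont (B : X -> X -> R[i]) (Q : X -> R) : psd_form B ->
  cont_seminorm Q -> hs_form B Q -> cont_seminorm (form_norm B).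
Proof.
move=> HB Qc [w [g [S [ws wg wB gS]]]].
have Q0 x : 0 <= Q x by apply: seminorm_ge0; case: Qc.
have S0 : 0 <= S by have := gS 0; rewrite big_geq.
apply: (@dominated_cont_seminorm _ _ (S + 1) _ Q) => // [|x].
  exact: form_norm_seminorm.
rewrite -(ler_pXn2r (ltn0Sn 1)) ?nnegrE ?form_norm_ge0 ?mulr_ge0 ?addr_ge0//.
apply: (cvgn_le_bound (wB x)) => N.
apply: (@le_trans _ _ ((\sum_(0 <= n < N) g n ^+ 2) * Q x ^+ 2)).
  rewrite mulr_suml; apply: ler_sum => n _; rewrite -exprMn.
  have [g0 gw] := wg n.
  by rewrite lerXn2r ?nnegrE ?modulus_ge0// mulr_ge0.
rewrite exprMn ler_wpM2r ?sqr_ge0// (le_trans (gS N))//; nra.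
Qed.

(** The next form is chosen to dominate a seminorm with enough room for the
    constants, which therefore disappear from the inequalities of the scale. *)
Lemma next_level (k : nat) (D : (X -> X -> R[i]) * (X -> R)) : scale_level D ->
  exists D', [/\ scale_level D', forall x, P k x <= form_norm D'.1 x,
    forall x, D.2 x <= form_norm D'.1 x,
    forall x, form_norm D.1 x <= form_norm D'.1 x
    & forall x, form_norm D.1 x ^+ 2 <= nrm x * form_norm D'.1 x].
Proof.
case: D => B Q [/= HB Qc BQ].
have Bc := hs_form_cont HB Qc BQ.
have [a [C1 C10 BP]] := fundamental_dominates HP Bc.
have [r [C2 C20 PP]] := P_dominating a.
have C12 : 0 <= C1 ^+ 2 * C2 by rewrite mulr_ge0 ?sqr_ge0 ?ltW.
pose p x := Q x + form_norm B x + P k x + C1 ^+ 2 * C2 * P r x.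
have pc : cont_seminorm p.
  apply: cont_seminorm_add; last by apply: cont_seminorm_scale.
  by apply: cont_seminorm_add => //; exact: cont_seminorm_add.
have [B' [Q' [HB' Qc' BQ' pB']]] := nuclear_hs_form nX pc.
have Q0 x : 0 <= Q x by apply: seminorm_ge0; case: Qc.
have P0 j x : 0 <= P j x by apply: seminorm_ge0; case: (PC j).
have B0 x := form_norm_ge0 B x.
have CP0 x : 0 <= C1 ^+ 2 * C2 * P r x by rewrite mulr_ge0.
exists (B', Q'); split => //= x; have := pB' x; rewrite /p;
  have := Q0 x; have := P0 k x; have := B0 x; have := CP0 x; try lra.
move=> h1 h2 h3 h4 h5.
apply: (@le_trans _ _ (nrm x * (C1 ^+ 2 * C2 * P r x))); last first.
  by rewrite ler_wpM2l ?form_norm_ge0//; lra.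
apply: (@le_trans _ _ ((C1 * P a x) ^+ 2)).
  by rewrite lerXn2r ?nnegrE// mulr_ge0 ?(ltW C10).
rewrite exprMn; apply: le_trans (ler_wpM2l (sqr_ge0 C1) (PP x)) _.
by apply: le_of_eq; ring.
Qed.

Lemma dominating_hilbert_scale : exists B : nat -> X -> X -> R[i],
  [/\ forall k, psd_form (B k) /\ continuous (form_norm (B k)),
      forall k x, form_norm (B k) x <= form_norm (B k.+1) x,
      forall k, hs_link (B k) (B k.+1),
      forall x, nrm x <= form_norm (B 0) x
    & (forall k x, form_norm (B k) x ^+ 2 <= nrm x * form_norm (B k.+1) x) /\
      forall k x, P k x <= form_norm (B k.+1) x].
Proof.
have [B0 [Q0 [HB0 Qc0 BQ0 pB0]]] := nuclear_hs_form nX nrmc.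
have /choice[nx nxP] : forall kD : nat * {D | scale_level D},
  exists D' : {D | scale_level D}, [/\ forall x, P kD.1 x <= form_norm (sval D').1 x,
    forall x, (sval kD.2).2 x <= form_norm (sval D').1 x,
    forall x, form_norm (sval kD.2).1 x <= form_norm (sval D').1 x
    & forall x, form_norm (sval kD.2).1 x ^+ 2 <= nrm x * form_norm (sval D').1 x].
  move=> [k [D HD]]; have [D' [HD' ? ? ? ?]] := next_level k HD.
  by exists (exist _ D' HD').
have HD0 : scale_level (B0, Q0) by [].
pose D := fix D k := if k is m.+1 then nx (m, D m) else exist scale_level _ HD0.
exists (fun k => (sval (D k)).1).
have DP k := svalP (D k).
have DN k := nxP (k, D k).
split=> [k|k x|k|x|].
- have [HB Qc BQ] := DP k; split => //.
  by have [] := hs_form_cont HB Qc BQ.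
- by have [] := DN k.
- have [_ _ [w [g [S [ws wg wB gS]]]]] := DP k; have [_ QB _ _] := DN k.
  exists w, g, S; split => // n x; have [g0 gw] := wg n.
  by apply: le_trans (gw x) _; rewrite ler_wpM2l//; exact: QB.
- exact: pB0.
- by split=> k x; have [] := DN k.
Qed.

End HilbertScaleConstruction.

(** * The space of rapidly decreasing sequences *)

Section SpaceOfRapidlyDecreasingSequences.
Context {R : realType}.
Local Notation s := (s_space R).

Lemma nneseries_EFin (u : nat -> R) l : series u @ \oo --> l ->
  (\sum_(0 <= j <oo) (u j)%:E)%E = l%:E.
Proof.
move=> ul; apply/cvg_lim => //.
rewrite (_ : (fun n => _) = EFin \o series u); first by apply: cvg_EFin => //; near=> n.
by apply/funext => n; rewrite /= sumEFin.
Unshelve. all: by end_near. Qed.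

Lemma s_series q (x : s) :
  series (fun j => (j.+1%:R ^+ q * modulus (x j)) ^+ 2) @ \oo --> s_norm q x ^+ 2.
Proof.
have xs : rapidly_decreasing x by case: x => xi /= hx; move: hx; rewrite inE.
have wfin : wsum q x \is a fin_num by rewrite ge0_fin_numE ?wsum_ge0.
rewrite /s_norm sqr_sqrtr; last by rewrite fine_ge0// wsum_ge0.
have : (fun n => (\sum_(0 <= j < n) ((modulus (x j)) ^+ 2 * (j.+1%:R) ^+ (2 * q))%R%:E)%E)
    @ \oo --> (fine (wsum q x))%:E.
  rewrite fineK//; apply: is_cvg_nneseries => j _ _.
  by rewrite lee_fin mulr_ge0 ?sqr_ge0// exprn_ge0.
move=> /fine_cvg; apply: cvg_trans; apply: near_eq_cvg; near=> n.
rewrite /= sumEFin /=; apply: eq_bigr => j _.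
by rewrite exprMn -exprM mulrC (mulnC 2).
Unshelve. all: by end_near. Qed.

Lemma s_norm_ge0 q (x : nat -> R[i]) : 0 <= s_norm q x.
Proof. exact: sqrtr_ge0. Qed.

Lemma s_coordinate_scalar j : scalar (fun x : s => x j).
Proof. by move=> a [x hx] [y hy]. Qed.

Lemma s_norm_form q : exists2 B : s -> s -> R[i],
  psd_form B & forall x, form_norm B x = s_norm q x.
Proof.
have ws j : scalar (fun x : s => (j.+1%:R ^+ q)%:C%C * x j).
  by move=> a x y; rewrite s_coordinate_scalar; ring.
have wN (x : s) : series (fun j => modulus ((j.+1%:R ^+ q)%:C%C * x j) ^+ 2)
    @ \oo --> s_norm q x ^+ 2.
  rewrite (_ : (fun j => _) = fun j => (j.+1%:R ^+ q * modulus (x j)) ^+ 2).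
    exact: s_series.
  apply/funext => j; rewrite ComplexField.Normc.normcM modulus_real ger0_norm//.
have [B HB BN] := limit_form ws wN.
exists B => // x; apply/eqP.
by rewrite -(@eqrXn2 _ 2)// ?form_norm_ge0 ?s_norm_ge0// BN.
Qed.

Lemma s_norm_seminorm q : is_seminorm (fun x : s => s_norm q x).
Proof.
have [B HB BN] := s_norm_form q.
by rewrite (_ : (fun x : s => _) = form_norm B); [exact: form_norm_seminorm|exact/funext].
Qed.

Lemma s_coordinate_le q (x : s) j : j.+1%:R ^+ q * modulus (x j) <= s_norm q x.
Proof.
rewrite -(ler_pXn2r (ltn0Sn 1)) ?nnegrE ?s_norm_ge0 ?mulr_ge0 ?exprn_ge0 ?modulus_ge0//.
apply: (@le_trans _ _ (\sum_(0 <= k < j.+1) (k.+1%:R ^+ q * modulus (x k)) ^+ 2)); last first.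
  by apply: nneg_series_le; [move=> k; exact: sqr_ge0|exact: s_series].
by rewrite big_nat_recr//= lerDr sumr_ge0// => k _; exact: sqr_ge0.
Qed.

Lemma wsum_le q (x : nat -> R[i]) (C : R) :
  (forall j, modulus (x j) <= C / j.+1%:R ^+ q.+1) -> (wsum q x <= (2 * C ^+ 2)%:E)%E.
Proof.
move=> xC; have C0 : 0 <= C.
  by have := xC 0; rewrite expr1n divr1; apply: le_trans; exact: modulus_ge0.
apply: lime_le; first by apply: is_cvg_nneseries => j _ _;
  rewrite lee_fin mulr_ge0 ?sqr_ge0// exprn_ge0.
near=> n; rewrite sumEFin lee_fin.
apply: (@le_trans _ _ (\sum_(0 <= j < n) C ^+ 2 * j.+1%:R ^- 2)).
  apply: ler_sum => j _.
  apply: (@le_trans _ _ ((C / j.+1%:R ^+ q.+1) ^+ 2 * j.+1%:R ^+ (2 * q))).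
    rewrite ler_wpM2r ?exprn_ge0// lerXn2r ?nnegrE ?modulus_ge0//.
    by rewrite divr_ge0 ?exprn_ge0.
  rewrite expr_div_n -exprM mulSn [(q * 2)%N]mulnC exprD invfM -!mulrA mulVf ?mulr1//.
rewrite -mulr_sumr mulrC ler_wpM2r ?sqr_ge0//.
exact: sum_inv_sq_le.
Unshelve. all: by end_near. Qed.

Lemma s_norm_bound q (x : nat -> R[i]) (C : R) :
  (forall j, modulus (x j) <= C / j.+1%:R ^+ q.+1) -> s_norm q x <= 2 * C.
Proof.
move=> xC; have C0 : 0 <= C.
  by have := xC 0; rewrite expr1n divr1; apply: le_trans; exact: modulus_ge0.
have le2 := wsum_le xC.
have fin : wsum q x \is a fin_num.
  by rewrite ge0_fin_numE ?wsum_ge0// (le_lt_trans le2)// ltry.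
rewrite -(ler_pXn2r (ltn0Sn 1)) ?nnegrE ?s_norm_ge0 ?mulr_ge0//.
rewrite sqr_sqrtr ?fine_ge0 ?wsum_ge0//.
have : fine (wsum q x) <= 2 * C ^+ 2 by rewrite -lee_fin fineK.
by move/le_trans; apply; rewrite exprMn; have := sqr_ge0 C; lra.
Qed.

Lemma s_nbhsP (x : s) (A : set s) : nbhs x A <->
  exists q, exists2 e : R, 0 < e & [set y : s | s_norm q (y - x : s) < e] `<=` A.
Proof.
rewrite nbhsE /=; split => [[U [oU Ux] UA]|[q [e e0 eA]]].
  have [q [e e0 qe]] := oU x Ux; exists q, e => // y /qe; exact: UA.
exists [set y : s | s_norm q (y - x : s) < e] => //; split; last first.
  by rewrite /= subrr (seminorm0 (s_norm_seminorm q)).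
move=> y /= yx; exists q, (e - s_norm q (y - x : s)); first by rewrite subr_gt0.
move=> z /= zy; have := seminormD (s_norm_seminorm q) (z - y) (y - x).
by rewrite addrA subrK; lra.
Qed.

End SpaceOfRapidlyDecreasingSequences.

(** * Embedding a nuclear space with a dominating Hilbert norm *)

Section Embedding.
Context {R : realType} (X : tvsType R[i]).
Variables (f : X -> X -> R[i]) (P : nat -> X -> R).
Hypothesis Hf : psd_form f.
Hypothesis f_norm : is_norm (form_norm f).
Hypothesis nX : nuclear X.
Hypothesis HP : increasing_fundamental_system P.
Hypothesis f_cont : continuous (form_norm f).
Hypothesis P_dominating : forall q, exists r, exists2 C : R, 0 < C &
  forall x, P q x ^+ 2 <= C * form_norm f x * P r x.

Lemma isometric_embedding : exists V : {linear X -> s_space R},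
  homeo_onto_image V /\ forall x : X, l2_norm (V x) = form_norm f x.
Proof.
have [B [HBc h_mono h_link nrm_le [h_dom P_le]]] :=
  dominating_hilbert_scale Hf nX HP f_cont P_dominating.
have HB k : psd_form (B k) by case: (HBc k).
have hc k : cont_seminorm (form_norm (B k)).
  by split; [exact: form_norm_seminorm|case: (HBc k)].
have [v [vs vn vdecay vlower]] :=
  isometric_functionals HB Hf h_mono h_link nrm_le h_dom.
have vrd x : (fun j => v j x) \in @s_pred R.
  rewrite inE => q; have [C [r [_ CP]]] := vdecay q.+1.
  apply: le_lt_trans (ltry (2 * (C * form_norm (B r) x) ^+ 2)).
  by apply: wsum_le => j; rewrite mulrAC; exact: CP.
pose V0 x : s_space R := SSpace (vrd x).
have V0lin : linear V0.
  move=> a x y; apply: val_inj; apply/funext => j.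
  by rewrite linearP /= vs.
pose V : {linear X -> s_space R} :=
  HB.pack V0 (GRing.isLinear.Build R[i] X (s_space R) *:%R V0 V0lin).
have lower q : exists (k : nat) (C : R), 0 < C /\
    forall x, P q x <= C * s_norm k (V x).
  have [k [C [C0 CP]]] := vlower q.+1; exists k, C; split => // x.
  apply: le_trans (P_le q x) _; apply: CP => [|j]; first exact: s_norm_ge0.
  by rewrite ler_pdivlMr ?exprn_gt0// mulrC; exact: (s_coordinate_le k (V x) j).
have V_inj : injective V.
  move=> x y Vxy; apply/eqP; rewrite -subr_eq0; apply/eqP.
  case: f_norm => _; apply.
  have nc : cont_seminorm (form_norm f) by split => //; exact: form_norm_seminorm.
  have [k [C C0 le1]] := fundamental_dominates HP nc.
  have [k' [C' [C'0 le2]]] := lower k.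
  have z0 : s_norm k' (V (x - y)) = 0.
    by rewrite linearB Vxy subrr (seminorm0 (s_norm_seminorm k')).
  apply/eqP; rewrite eq_le form_norm_ge0 andbT; apply: le_trans (le1 _) _.
  rewrite -(mulr0 C) ler_wpM2l ?(ltW C0)//; have := le2 (x - y).
  by rewrite z0 mulr0.
exists V; split; last first.
  move=> x; rewrite /l2_norm.
  rewrite (nneseries_EFin (vn x)) /= sqrtr_sqr ger0_norm//.
  exact: form_norm_ge0.
split.
  move=> x A /s_nbhsP[q [e e0 eA]].
  have [C [r [C0 CP]]] := vdecay q.+1.
  have e1 : 0 < e / (2 * C) by rewrite divr_gt0// mulr_gt0.
  apply: filterS (seminorm_nbhs (hc r) x e1) => y.
  rewrite /mkset ltr_pdivlMr ?mulr_gt0// => yx; apply: eA.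
  rewrite /mkset -linearB; apply: le_lt_trans yx.
  rewrite mulrC -mulrA; apply: s_norm_bound => j.
  by rewrite mulrAC; exact: CP.
pose g (eta : s_space R) : X := xget 0 [set x | V x = eta].
have gV : cancel V g.
  move=> x; apply: V_inj.
  by have := xgetPex (0 : X) (ex_intro (fun y => V y = V x) x erefl).
exists g; split => //; apply/subspace_continuousP => _ [x _ <-] U.
rewrite [X in nbhs X U -> _](gV x) => nU.
have [q [e e0 qe]] : exists q, exists2 e : R, 0 < e & [set y | P q y < e] `<=` [set y | U (y + x)].
  case: HP => _ _ <-.
  by have := @add_cst_continuous _ X x 0 U; rewrite add0r => /(_ nU).
have [k [C [C0 le1]]] := lower q.
apply/s_nbhsP; exists k, (e / C); first exact: divr_gt0.
move=> eta; rewrite /mkset => + [y _ yeta]; rewrite -yeta -linearB ltr_pdivlMr// mulrC => lt1.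
suff : U (g (V y)) by []; rewrite gV.
have := qe (y - x); rewrite /= subrK; apply.
exact: le_lt_trans (le1 _) lt1.
Qed.

End Embedding.

(** * Subspaces of the space of rapidly decreasing sequences *)

Lemma dot_psd_form {R : realType} {X : lmodType R[i]}
  (d : {dot X for (@Num.conj R[i])}) : psd_form d.
Proof.
have add u x y : d (x + y) u = d x u + d y u.
  have := @zmod_morphisml_subproof _ _ _ _ _ _ d u x (- y).
  have := @zmod_morphisml_subproof _ _ _ _ _ _ d u 0 y.
  have := @zmod_morphisml_subproof _ _ _ _ _ _ d u 0 0.
  by rewrite !subrr => d0; rewrite sub0r d0 sub0r => dN; rewrite opprK dN opprK.
split=> [a x y z|x y|x].
- by rewrite add [d (a *: x) z](@linearl_subproof _ _ _ _ _ _ d z a x).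
- by rewrite (@hermitian_subproof _ _ _ _ d y x) expr0 mul1r.
- have [->|x0] := eqVneq x 0.
    have := @zmod_morphisml_subproof _ _ _ _ _ _ d 0 0 0.
    by rewrite subrr => ->; rewrite subrr.
  by have := @neq0_dnorm_gt0 _ _ _ d x x0; rewrite ltcE => /andP[_ /ltW].
Qed.

Lemma psd_form_dot {R : realType} {X : lmodType R[i]} (B : X -> X -> R[i]) :
  psd_form B -> (forall x, form_norm B x = 0 -> x = 0) ->
  exists d : {dot X for (@Num.conj R[i])}, forall x, d x x = (form_norm B x ^+ 2)%:C%C.
Proof.
move=> HB B0.
have bil : bilinear_for *%R (Num.conj \; *%R) B.
  split=> [u a x y|u a x y]; first exact: psd_lin.
  by rewrite formDr// formZr.
have herm x y : B x y = (-1) ^+ false * Num.conj (B y x).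
  by rewrite expr0 mul1r; exact: psd_conj.
have pos x : x != 0 -> 0 < B x x.
  move=> x0; rewrite form_diag// ltcR exprn_gt0// lt_neqAle form_norm_ge0 andbT eq_sym.
  by apply/eqP => /B0/eqP; rewrite (negbTE x0).
pose d : {dot X for (@Num.conj R[i])} := HB.pack B
  (bilinear_isBilinear.Build R[i] X X R[i] *%R (Num.conj \; *%R) B bil)
  (isHermitianSesquilinear.Build R[i] X false Num.conj B herm)
  (isDotProduct.Build R[i] X B pos).
by exists d => x; exact: form_diag.
Qed.

Section Subspace.
Context {R : realType} (X : tvsType R[i]).
Variable V : {linear X -> s_space R}.
Hypothesis V_homeo : homeo_onto_image V.

Let p q x := s_norm q (V x).

Let p_form q : exists2 B : X -> X -> R[i], psd_form B & forall x, form_norm B x = p q x.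
Proof.
have [B HB BN] := s_norm_form (R := R) q.
exists (fun x y => B (V x) (V y)) => [|x]; last exact: BN.
split=> [a x y z|x y|x]; last exact: (psd_ge0 HB (V x)).
- by rewrite linearP (psd_lin HB).
- exact: (psd_conj HB).
Qed.

Let p_seminorm q : is_seminorm (p q).
Proof.
by have [B HB BN] := p_form q; rewrite (_ : p q = form_norm B);
  [exact: form_norm_seminorm|exact/funext].
Qed.

Let p_ge0 q x : 0 <= p q x. Proof. exact: s_norm_ge0. Qed.

Let p_mono q r x : (q <= r)%N -> p q x <= p r x.
Proof. exact: s_norm_le. Qed.

Lemma embedding_fundamental_system : increasing_fundamental_system p.
Proof.
split=> [//|q x|A]; first by apply: p_mono.
have [Vc [g [gV gc]]] := V_homeo; split=> [nA|[q [e e0 qe]]].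
  have /subspace_continuousP/(_ (V 0)) := gc.
  have V0 : range V (V 0) by exists 0.
  move=> /(_ V0 A); rewrite [X in nbhs X A -> _](gV 0) => /(_ nA).
  move=> /s_nbhsP[q [e e0 qe]]; exists q, e => // x; rewrite /mkset => px.
  have : A (g (V x)) by apply: (qe (V x)); [rewrite /mkset -linearB subr0|exists x].
  by rewrite gV.
have : nbhs (V 0) [set eta : s_space R | s_norm q (eta - V 0 : s_space R) < e].
  by apply/s_nbhsP; exists q, e.
move=> /(Vc 0) nV; apply: (@filterS _ (nbhs (0 : X)) _ _ _ _ nV) => x pxe.
by apply: qe; move: pxe; rewrite /preimage /mkset -linearB subr0.
Qed.

Let p_cont := fundamental_cont embedding_fundamental_system.

(** The Cauchy-Schwarz inequality for the sequences [|x_j|] and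
    [|x_j| * (j + 1) ^ (2 * q)]. *)
Lemma s_norm_interpolation q x : p q x ^+ 2 <= p 0 x * p (2 * q) x.
Proof.
rewrite -(ler_pXn2r (ltn0Sn 1)) ?nnegrE ?sqr_ge0 ?mulr_ge0// [leRHS]exprMn.
apply: sqr_le_of_quadratic => [|||t t0]; rewrite ?sqr_ge0//.
have cq : (fun n => 2 * t * series (fun j => (j.+1%:R ^+ q * modulus (V x j)) ^+ 2) n)
    @ \oo --> 2 * t * p q x ^+ 2.
  by apply: cvgMr; exact: s_series.
apply: (cvgn_le_bound cq) => n; rewrite /series /=.
have le0 := @nneg_series_le _ _ _ n (fun j => sqr_ge0 _) (@s_series R 0 (V x)).
have le2 := @nneg_series_le _ _ _ n (fun j => sqr_ge0 _) (@s_series R (2 * q) (V x)).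
apply: le_trans (lerD le0 (ler_wpM2l (sqr_ge0 t) le2)).
rewrite !mulr_sumr -big_split /=; apply: ler_sum => j _.
rewrite expr0 mul1r mul2n -addnn exprD.
set a := _ ^+ q; set m := modulus _.
by rewrite -subr_ge0 (_ : _ - _ = (m - t * (a * a * m)) ^+ 2) ?sqr_ge0//; ring.
Qed.

(** [x = \sum_n (V x)_n P e_n], where [P] is the orthogonal projection onto
    the closure of the image for the norm of index [q]: the projections [P e_n]
    lie in the completion, and are given by their approximations in the space. *)
Lemma embedding_nuclear : nuclear X.
Proof.
move=> P Ps Pc.
have [q [C C0 PC]] := fundamental_dominates embedding_fundamental_system (conj Ps Pc).
have [B HB BN] := p_form q.
pose c n : R := (C * n.+1%:R ^+ (q + 2))^-1.
have c0 n : 0 < c n by rewrite invr_gt0 mulr_gt0// exprn_gt0.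
have ys n : scalar (fun x => V x n) by move=> a x x'; rewrite linearP s_coordinate_scalar.
pose y n : {scalar X} :=
  HB.pack (fun x => V x n) (GRing.isLinear.Build R[i] X R[i] *%R (fun x => V x n) (ys n)).
have yE n x : y n x = V x n by [].
pose Y n x := (n.+1%:R ^+ (2 * q))%:C%C * V x n.
have Ys n : scalar (Y n) by move=> a x x'; rewrite /Y ys; ring.
have YB n x : modulus (Y n x) <= n.+1%:R ^+ q * form_norm B x.
  rewrite BN /Y ComplexField.Normc.normcM modulus_real ger0_norm//.
  rewrite mul2n -addnn exprD -mulrA ler_wpM2l ?exprn_ge0//.
  exact: s_coordinate_le.
have /choice[z zP] : forall nm : nat * nat, exists z, forall x,
    modulus (Y nm.1 x - B x z) <= nm.2.+1%:R^-1 * form_norm B x.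
  by move=> [n m]; apply: approximate_riesz (Ys n) (YB n) _.
have z_norm n m : p q (z (n, m)) <= n.+1%:R ^+ q + 1.
  set u := z (n, m); rewrite -BN.
  apply: le_of_sqr_le_mul; rewrite ?form_norm_ge0 ?addr_ge0 ?exprn_ge0//.
  have -> : form_norm B u ^+ 2 = modulus (Y n u - (Y n u - B u u)).
    by rewrite subKr (form_diag HB) modulus_real ger0_norm ?sqr_ge0.
  apply: le_trans (le_normcD _ _) _; rewrite normcN mulrDl.
  apply: lerD; first exact: YB.
  apply: le_trans (zP (n, m) u) _; rewrite ler_wpM2r ?form_norm_ge0//.
  by rewrite invf_le1 ?ler1n.
have z_cauchy n : seminorm_cauchy P (fun m => z (n, m)).
  move=> e e0.
  have [N NP] : exists N, 2 * C / N.+1%:R < e.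
    have C2 : 0 < 2 * C by rewrite mulr_gt0.
    have [N _ NP] := cvgr_lt _ (@cvg_harmonic R) _ (divr_gt0 e0 C2).
    exists N; have := NP N (leqnn N); rewrite /harmonic /= ltr_pdivlMr//.
    by rewrite mulrC.
  exists N => m k Nm Nk; apply: le_lt_trans NP.
  apply: le_trans (PC _) _; rewrite [2 * C]mulrC -mulrA ler_wpM2l ?(ltW C0)//.
  rewrite -BN; set d := z (n, m) - z (n, k).
  have small l : (N <= l)%N -> modulus (Y n d - B d (z (n, l))) <= N.+1%:R^-1 * form_norm B d.
    move=> Nl; apply: le_trans (zP (n, l) d) _; rewrite ler_wpM2r ?form_norm_ge0//.
    by rewrite lef_pV2 ?posrE// ler_nat.
  apply: le_of_sqr_le_mul; rewrite ?form_norm_ge0 ?divr_ge0//.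
  have -> : form_norm B d ^+ 2 =
      modulus ((Y n d - B d (z (n, k))) - (Y n d - B d (z (n, m)))).
    rewrite opprB addrC addrA subrK -(formBr HB) -/d (form_diag HB) modulus_real.
    by rewrite ger0_norm ?sqr_ge0.
  apply: le_trans (le_normcD _ _) _; rewrite normcN.
  apply: le_trans (lerD (small k Nk) (small m Nm)) _.
  by rewrite -mulrDl; apply: le_of_eq; congr (_ * _); ring.
have Q_cont : cont_seminorm (fun x => C * p (q + 2) x).
  by apply: cont_seminorm_scale; [exact: ltW|exact: p_cont].
exists (fun x => C * p (q + 2) x); split; [by case: Q_cont|by case: Q_cont| |].
  move=> x; apply: le_trans (PC x) _; rewrite ler_wpM2l ?(ltW C0)//.
  by apply: p_mono; exact: leq_addr.
have completion_ge0 u : seminorm_cauchy P u -> 0 <= completion_norm P u.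
  move=> /(completion_cvg Ps) cu; rewrite -(cvg_lim _ cu)//; apply: limr_ge.
    by apply/cvg_ex; exists (completion_norm P u).
  by near=> m; exact: seminorm_ge0.
have completion_le u b : seminorm_cauchy P u -> (forall m, P (u m) <= b) ->
    completion_norm P u <= b.
  by move=> /(completion_cvg Ps) cu ub; exact: cvgn_le_bound cu ub.
exists y, c, (fun n m => z (n, m)); split => //.
- move=> n; split => [|x]; first exact: ltW.
  rewrite yE /c invfM mulrAC mulrCA mulrA mulfV ?mul1r ?gt_eqF//.
  rewrite ler_pdivlMr ?exprn_gt0// mulrC; exact: s_coordinate_le.
- apply: (@nneg_series_cvg _ _ 4) => [n|N].
    by rewrite mulr_ge0 ?(ltW (c0 n))//; exact: completion_ge0.
  apply: (@le_trans _ _ (\sum_(0 <= n < N) 2 * n.+1%:R ^- 2)); last first.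
    by rewrite -mulr_sumr; have := @sum_inv_sq_le R N; lra.
  apply: ler_sum => n _; have nq : 1 <= n.+1%:R ^+ q :> R by rewrite exprn_ege1// ler1n.
  apply: (@le_trans _ _ (c n * (C * (2 * n.+1%:R ^+ q)))).
    rewrite ler_wpM2l ?(ltW (c0 n))//; apply: completion_le => // m.
    apply: le_trans (PC _) _; rewrite ler_wpM2l ?(ltW C0)//.
    by apply: le_trans (z_norm n m) _; lra.
  apply: le_of_eq; rewrite /c exprD; field.
  by rewrite ?expf_neq0 ?gt_eqF.
- move=> x.
  (* The form of the tail of index [N] of the sequences: its norm at [x] bounds
     the distance of [x] to the partial sums of its expansion. *)
  pose T N v v' := B v v' - \sum_(0 <= n < N)
    ((n.+1%:R ^+ q)%:C%C * V v n) * conjc ((n.+1%:R ^+ q)%:C%C * V v' n).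
  pose u n v := (n.+1%:R ^+ q)%:C%C * V v n.
  have us n : scalar (u n) by move=> a v v'; rewrite /u ys; ring.
  have uE n v : modulus (u n v) = n.+1%:R ^+ q * modulus (V v n).
    by rewrite /u ComplexField.Normc.normcM modulus_real ger0_norm.
  have u_le N v : \sum_(0 <= n < N) modulus (u n v) ^+ 2 <= p q v ^+ 2.
    under eq_bigr do rewrite uE.
    by apply: nneg_series_le; [move=> n; exact: sqr_ge0|exact: s_series].
  have HT N : psd_form (T N).
    apply: (psd_form_sub HB (psd_form_sum N us)) => v.
    rewrite -(ler_pXn2r (ltn0Sn 1)) ?nnegrE ?form_norm_ge0//.
    by rewrite sqr_form_norm_sum// BN.
  have TN N v : form_norm (T N) v ^+ 2 =
      p q v ^+ 2 - \sum_(0 <= n < N) modulus (u n v) ^+ 2.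
    rewrite (sqr_form_norm (HT N)) /T ReB -(sqr_form_norm HB) BN.
    by rewrite -(sqr_form_norm_sum us) (sqr_form_norm (psd_form_sum N us)).
  have T_le N v : form_norm (T N) v <= p q v.
    rewrite -(ler_pXn2r (ltn0Sn 1)) ?nnegrE ?form_norm_ge0// TN gerBl.
    by apply: sumr_ge0 => n _; exact: sqr_ge0.
  have cauchyN N := seminorm_cauchy_sub_sum x (fun n => y n x) N Ps z_cauchy.
  pose K N := \sum_(0 <= n < N) modulus (V x n).
  have approx N m : p q (x - \sum_(0 <= n < N) y n x *: z (n, m)) <=
      form_norm (T N) x + K N * m.+1%:R^-1.
    set v := x - _.
    have K0 : 0 <= K N by apply: sumr_ge0 => n _; exact: modulus_ge0.
    have split_form : B v v = T N v x +
        \sum_(0 <= n < N) conjc (V x n) * (Y n v - B v (z (n, m))).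
      rewrite {2}/v (formBr HB) (form_sumr HB) /T -addrA; congr (_ + _).
      rewrite -!sumrN -big_split /=; apply: eq_bigr => n _.
      rewrite (formZr HB) conjM conjc_real /Y mul2n -addnn exprD realM /=; ring.
    rewrite -BN.
    apply: le_of_sqr_le_mul; rewrite ?form_norm_ge0 ?addr_ge0 ?form_norm_ge0 ?mulr_ge0//.
    have -> : form_norm B v ^+ 2 = modulus (B v v).
      by rewrite (form_diag HB) modulus_real ger0_norm ?sqr_ge0.
    rewrite split_form mulrDl; apply: le_trans (le_normcD _ _) _; apply: lerD.
      apply: le_trans (form_cauchy_schwarz (HT N) _ _) _.
      by rewrite mulrC ler_wpM2l ?form_norm_ge0// BN.
    apply: le_trans (modulus_sum _ _) _; rewrite /K !mulr_suml.
    apply: ler_sum => n _; rewrite ComplexField.Normc.normcM modulus_conj -mulrA.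
    by rewrite ler_wpM2l ?modulus_ge0//; exact: (zP (n, m) v).
  have bound N : completion_norm P (fun m => x - \sum_(0 <= n < N) y n x *: z (n, m))
      <= C * form_norm (T N) x.
    have lim : (fun m => C * (form_norm (T N) x + K N * m.+1%:R^-1)) @ \oo -->
        C * (form_norm (T N) x + K N * 0).
      by apply: cvgMr; apply: cvgD; [exact: cvg_cst|apply: cvgMr; exact: cvg_harmonic].
    rewrite mulr0 addr0 in lim; rewrite -(cvg_lim _ lim)//.
    rewrite -(cvg_lim _ (completion_cvg Ps (cauchyN N)))//.
    apply: ler_lim.
    + by apply/cvg_ex; eexists; exact: (completion_cvg Ps (cauchyN N)).
    + by apply/cvg_ex; eexists; exact: lim.
    + near=> m.
      apply: (@le_trans _ _ (C * p q (x - \sum_(0 <= n < N) y n x *: z (n, m)))).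
        exact: PC.
      by rewrite ler_wpM2l ?(ltW C0)//; exact: (approx N m).
  have T0 : (fun N => form_norm (T N) x) @ \oo --> (0 : R).
    have sqT : (fun N => form_norm (T N) x ^+ 2) @ \oo --> (0 : R).
      rewrite (_ : (fun N => _) = fun N => p q x ^+ 2 -
          series (fun n => (n.+1%:R ^+ q * modulus (V x n)) ^+ 2) N).
        rewrite -[X in _ --> X](subrr (p q x ^+ 2)); apply: cvgB; first exact: cvg_cst.
        exact: s_series.
      apply/funext => N; rewrite TN; congr (_ - _).
      by apply: eq_bigr => n _; rewrite uE.
    rewrite (_ : (fun N => _) = Num.sqrt \o (fun N => form_norm (T N) x ^+ 2)).
      rewrite -[X in _ --> X]sqrtr0; apply: continuous_cvg => //.
      exact: sqrt_continuous.
    by apply/funext => N /=; rewrite sqrtr_sqr ger0_norm ?form_norm_ge0.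
  apply: (@squeeze_cvgr _ _ _ _ (cst 0) (fun N => C * form_norm (T N) x)).
  + by near=> N; rewrite bound andbT /=; exact: completion_ge0.
  + exact: cvg_cst.
  + by rewrite -[X in _ --> X](mulr0 C); apply: cvgMr.
Unshelve. all: by end_near. Qed.

Variable nrm : X -> R.
Hypothesis nrm_seminorm : is_seminorm nrm.
Hypothesis V_isometric : forall x, l2_norm (V x) = nrm x.

Let nrmE : nrm = p 0.
Proof.
apply/funext => x; rewrite -V_isometric /l2_norm /p /s_norm /wsum.
congr (Num.sqrt (fine _)); apply: eq_eseriesr => j _.
by rewrite muln0 expr0 mulr1.
Qed.

Lemma embedding_norm : is_norm nrm.
Proof.
split => // x nx0; have [_ [g [gV _]]] := V_homeo.
suff : V x = V 0 by move=> Vx; rewrite -(gV x) Vx gV.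
rewrite linear0; apply: val_inj; apply/funext => j.
apply: ComplexField.Normc.eq0_normc; apply/eqP; rewrite eq_le modulus_ge0 andbT.
have := s_coordinate_le 0 (V x) j.
by rewrite expr0 mul1r -/(p 0 x) -nrmE nx0.
Qed.

Lemma embedding_dominating : dominating_norm nrm.
Proof.
split; first exact: embedding_norm.
  by rewrite nrmE; case: (p_cont 0).
exists p; split; first exact: embedding_fundamental_system.
move=> q; exists (2 * q)%N, 1 => // x; rewrite mul1r nrmE.
exact: s_norm_interpolation.
Qed.

Lemma embedding_hilbert : is_hilbert_norm nrm.
Proof.
split; first exact: embedding_norm.
have [B HB BN] := p_form 0.
have B0 x : form_norm B x = 0 -> x = 0.
  by rewrite BN -nrmE; case: embedding_norm => _; exact.
have [d dB] := psd_form_dot HB B0; exists d => x.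
by rewrite dB BN nrmE.
Qed.

End Subspace.

Theorem theorem14 (R : realType) (X : tvsType R[i]) (nrm : X -> R)
    (hX : frechet X) (hnrm : is_seminorm nrm) :
  (exists V : {linear X -> s_space R},
     homeo_onto_image V /\ forall x : X, l2_norm (V x) = nrm x)
  <->
  (nuclear X /\ dominating_norm nrm /\ is_hilbert_norm nrm).
Proof.
split=> [[V [Vh Vn]]|[nX [[nn nc [P [HP P_dom]]] [_ [d dn]]]]].
  split; first exact: embedding_nuclear Vh.
  split; first exact: embedding_dominating Vh _ hnrm Vn.
  exact: embedding_hilbert Vh _ hnrm Vn.
have Hd := dot_psd_form d.
have dE : form_norm d = nrm.
  apply/funext => x; rewrite /form_norm dn /= sqrtr_sqr ger0_norm//.
  exact: seminorm_ge0.
rewrite -dE in nn nc P_dom *.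
exact: isometric_embedding Hd nn nX HP nc P_dom.
Qed.
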